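(* Let $N\ge2$. Assume that $r,R\in(1,e)$ and a bounded domain $\Omega\subset\mathbb{R}^N$ with $C^2$-boundary satisfy $$\max\{1,e\ln R\}<r\le R<e\quad\text{and}\quad B_r\subset\Omega\subset B_R.$$ Then the function $p\mapsto\lambda_1(p,\Omega)$, $p\in(1,\infty)$, has a maximum point $p^*>1$, and hence it is non-monotone. In particular, if $\Omega=B_R$ with $R\in(1,e)$, then $\lambda_1(p,\Omega)$ is non-monotone with respect to $p$.
   Context: For $p>1$, $\lambda_1(p,\Omega)=\inf\{\int_\Omega|\nabla u|^p dx/\int_\Omega |u|^p dx: u\in W_0^{1,p}(\Omega)\setminus\{0\}\}$ is the first Dirichlet eigenvalue of $-\Delta_p$ in $\Omega$, where $\Delta_p u=\operatorname{div}(|\nabla u|^{p-2}\nabla u)$. $B_\rho$ denotes an open ball of radius $\rho$ in $\mathbb{R}^N$ whose center is not fixed: $B_r\subset\Omega$ (resp. $\Omega\subset B_R$) means that the inclusion holds for some choice of center. *)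

(* Defs.v *)
From HB Require Import structures.
From mathcomp Require Import all_boot all_order all_algebra.
From mathcomp Require Import all_classical all_reals all_analysis.

Set Implicit Arguments.
Unset Strict Implicit.
Unset Printing Implicit Defensive.

Import Order.TTheory GRing.Theory Num.Theory.
Import numFieldTopology.Exports numFieldNormedType.Exports.

Local Open Scope classical_set_scope.
Local Open Scope ring_scope.

(** Row vectors carry the product sigma-algebra of the Borel sets of [R],
    i.e. the Borel sigma-algebra of R^n. *)

Fact measure_rV_display : measure_display.
Proof. exact: default_measure_display. Qed.

Section measurable_rV.
Context {R : realType}.
Variable n : nat.

Definition rV_coord (i : 'I_n) (x : 'rV[R]_n) : R := x ord0 i.

Let rV_set0 : g_sigma_preimage rV_coord set0.
Proof. exact: sigma_algebra0. Qed.

Let rV_setC A :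
  g_sigma_preimage rV_coord A -> g_sigma_preimage rV_coord (~` A).
Proof. exact: sigma_algebraC. Qed.

Let rV_bigcup (F : (set 'rV[R]_n)^nat) :
  (forall i, g_sigma_preimage rV_coord (F i)) ->
  g_sigma_preimage rV_coord (\bigcup_i (F i)).
Proof. exact: sigma_algebra_bigcup. Qed.

HB.instance Definition _ :=
  @isMeasurable.Build measure_rV_display 'rV[R]_n
    (g_sigma_preimage rV_coord) rV_set0 rV_setC rV_bigcup.

Lemma measurable_rV_coord (i : 'I_n) : measurable_fun [set: 'rV[R]_n] (rV_coord i).
Proof.
move=> _ Y mY; rewrite setTI; apply: sub_sigma_algebra => /=.
rewrite -bigcup_seq/=; exists i => /=; first by rewrite mem_index_enum.
by exists Y => //; rewrite setTI.
Qed.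

Lemma measurable_fun_rV d (T : measurableType d) (f : T -> 'rV[R]_n) :
  (forall i, measurable_fun [set: T] (rV_coord i \o f)) ->
  measurable_fun [set: T] f.
Proof.
move=> mf.
have sub : g_sigma_preimage (fun i => rV_coord i \o f) `<=` measurable.
  apply: smallest_sub; first exact: sigma_algebra_measurable.
  move=> A; rewrite -bigcup_seq/= => -[i _ [B mB <-]]; exact: mf.
rewrite g_sigma_preimage_comp in sub.
by move=> _ A mA; apply: sub; exists A.
Qed.

End measurable_rV.

Lemma prod_sigma_finite d1 d2 (T1 : measurableType d1) (T2 : measurableType d2)
    (R : realType) (m1 : {sigma_finite_measure set T1 -> \bar R})
    (m2 : {sigma_finite_measure set T2 -> \bar R}) :
  sigma_finite setT (m1 \x m2)%E.
Proof.
have /sigma_finiteP[F [TF ndF Foo]] := sigma_finiteT m1.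
have /sigma_finiteP[G [TG ndG Goo]] := sigma_finiteT m2.
exists (fun n => F n `*` G n).
  rewrite -setXTT TF TG predeqE => -[x y]; split.
    move=> [/= [n _ Fnx] [k _ Gky]]; exists (maxn n k) => //; split.
    - by move: x Fnx; exact/subsetPset/ndF/leq_maxl.
    - by move: y Gky; exact/subsetPset/ndG/leq_maxr.
  by move=> [n _ []/= ? ?]; split; exists n.
move=> k; have [? ?] := Foo k; have [? ?] := Goo k.
split; first exact: measurableX.
by rewrite product_measure1E// lte_mul_pinfty// ge0_fin_numE.
Qed.

(** N-dimensional Lebesgue measure, as an iterated product. *)

Section lebesgue_rV.
Context {R : realType}.

Definition rV_cons n (z : measurableTypeR R * 'rV[R]_n) : 'rV[R]_n.+1 :=
  \row_i oapp (fun j : 'I_n => z.2 ord0 j) z.1 (unlift ord0 i).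

Definition rV_uncons n (x : 'rV[R]_n.+1) : measurableTypeR R * 'rV[R]_n :=
  (x ord0 ord0, \row_j x ord0 (lift ord0 j)).

Lemma rV_consK n : cancel (@rV_cons n) (@rV_uncons n).
Proof.
move=> [a v]; rewrite /rV_uncons /rV_cons !mxE unlift_none/=; congr pair.
by apply/rowP => j; rewrite !mxE liftK.
Qed.

Lemma measurable_rV_cons n : measurable_fun setT (@rV_cons n).
Proof.
apply: measurable_fun_rV => i.
case: (unliftP ord0 i) => [j ->|->].
  rewrite (_ : _ \o _ = rV_coord j \o snd).
    apply: measurableT_comp; last exact: measurable_snd.
    exact: measurable_rV_coord.
  by apply/funext => z; rewrite /rV_coord /= mxE liftK.
rewrite (_ : _ \o _ = fst); first exact: measurable_fst.
by apply/funext => z; rewrite /rV_coord /= mxE unlift_none.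
Qed.

Lemma measurable_rV_uncons n : measurable_fun setT (@rV_uncons n).
Proof.
apply/measurable_fun_pairP; split; first exact: (measurable_rV_coord ord0).
apply: measurable_fun_rV => j.
rewrite (_ : _ \o _ = rV_coord (lift ord0 j)); first exact: measurable_rV_coord.
by apply/funext => x; rewrite /rV_coord /= mxE.
Qed.

Section step.
Variables (n : nat) (m : {sigma_finite_measure set 'rV[R]_n -> \bar R}).

Definition leb_cons : set 'rV[R]_n.+1 -> \bar R :=
  pushforward (@lebesgue_measure R \x m)%E (@rV_cons n).

Let leb_cons0 : leb_cons set0 = 0%E.
Proof. by rewrite /leb_cons /pushforward preimage_set0 measure0. Qed.

Let leb_cons_ge0 A : (0 <= leb_cons A)%E.
Proof. by rewrite /leb_cons /pushforward; exact: measure_ge0. Qed.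

Let leb_cons_sigma_additive : semi_sigma_additive leb_cons.
Proof.
move=> F mF tF mUF; rewrite /leb_cons /pushforward preimage_bigcup.
apply: measure_semi_sigma_additive.
- by move=> k; rewrite -[X in measurable X]setTI; exact: measurable_rV_cons.
- apply/trivIsetP => /= i j _ _ ij; rewrite -preimage_setI.
  by move/trivIsetP : tF => /(_ _ _ _ _ ij) ->//; rewrite preimage_set0.
- rewrite -preimage_bigcup -[X in measurable X]setTI.
  exact: measurable_rV_cons.
Qed.

HB.instance Definition _ := isMeasure.Build _ _ _
  leb_cons leb_cons0 leb_cons_ge0 leb_cons_sigma_additive.

Let leb_cons_sigma_finite : sigma_finite setT leb_cons.
Proof.
have [F FT mF] := prod_sigma_finite lebesgue_measure m.
exists (fun k => @rV_uncons n @^-1` F k).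
  by rewrite -preimage_bigcup -FT preimage_setT.
move=> k; have [mFk Fkoo] := mF k; split.
  by rewrite -[X in measurable X]setTI; exact: measurable_rV_uncons.
rewrite /leb_cons /pushforward -comp_preimage.
by rewrite (_ : _ \o _ = idfun) //; apply/funext => z; exact: rV_consK.
Qed.

HB.instance Definition _ :=
  @Measure_isSigmaFinite.Build _ _ _ leb_cons leb_cons_sigma_finite.
End step.

Fixpoint lebesgue_rV n : {sigma_finite_measure set 'rV[R]_n -> \bar R} :=
  if n is k.+1 then leb_cons (lebesgue_rV k) else \d_ (0 : 'rV[R]_0).
End lebesgue_rV.

Arguments lebesgue_rV {R} n.

Section euclidean.
Context {R : realType} {n : nat}.
Implicit Types (x c : 'rV[R]_n) (f : 'rV[R]_n -> R) (A : set 'rV[R]_n).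

(** The library norm on matrices is the sup norm, hence [enorm] and [eball];
    topological notions and boundedness do not depend on the choice. *)
Definition enorm x : R := Num.sqrt (\sum_(i < n) x ord0 i ^+ 2).

Definition eball c (r : R) : set 'rV[R]_n := [set x | enorm (x - c) < r].

Definition partial (i : 'I_n) f : 'rV[R]_n -> R :=
  fun x => 'D_(delta_mx ord0 i) f x.

Definition gradient f : 'rV[R]_n -> 'rV[R]_n :=
  fun x => \row_i partial i f x.

Fixpoint Ck (k : nat) f : Prop :=
  continuous f /\
  if k is k'.+1 then
    forall i : 'I_n,
      (forall x, derivable f x (delta_mx ord0 i)) /\ Ck k' (partial i f)
  else True.

Definition smooth f : Prop := forall k, Ck k f.

Definition boundary A : set 'rV[R]_n := closure A `\` A^°.

Definition bounded_domain A : Prop :=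
  [/\ open A, connected A, A !=set0 & bounded_set A].

End euclidean.

(** Near each boundary point, after relabelling and reorienting the coordinate
    axes, [A] is the strict epigraph of a C^2 function of the other n - 1
    coordinates. *)
Definition C2_boundary (R : realType) (n : nat) (A : set 'rV[R]_n) : Prop :=
  forall x0, boundary A x0 ->
  exists (rho : R) (i : 'I_n) (b : bool) (gamma : 'rV[R]_n.-1 -> R),
    [/\ 0 < rho, Ck 2 gamma &
        A `&` eball x0 rho =
        [set x | gamma (col' i x) < (-1) ^+ b * x ord0 i] `&` eball x0 rho].

Section sobolev.
Context {R : realType} {n : nat}.
Variable Omega : set 'rV[R]_n.
Implicit Types (p : R) (u f : 'rV[R]_n -> R) (g : 'rV[R]_n -> 'rV[R]_n).

Local Notation mu := (lebesgue_rV n).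

Definition test_function f : Prop :=
  let supp := closure [set x | f x != 0] in
  [/\ smooth f, compact supp & supp `<=` Omega].

Definition intpow p f : \bar R :=
  (\int[mu]_(x in Omega) (`|f x| `^ p)%:E)%E.

Definition Lp p f : Prop :=
  measurable_fun Omega f /\ (intpow p f < +oo)%E.

Definition weak_gradient u g : Prop :=
  forall (phi : 'rV[R]_n -> R) (i : 'I_n), test_function phi ->
    (\int[mu]_(x in Omega) (u x * partial i phi x) =
     - \int[mu]_(x in Omega) (g x ord0 i * phi x))%R.

(** [W1p p u g]: [u] is in W^{1,p}(Omega), with weak gradient [g]. *)
Definition W1p p u g : Prop :=
  [/\ Lp p u, forall i, Lp p (fun x => g x ord0 i) & weak_gradient u g].

(** W_0^{1,p}(Omega) is the closure of the test functions in W^{1,p}(Omega). *)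
Definition W01p p u g : Prop :=
  W1p p u g /\
  exists phi : nat -> 'rV[R]_n -> R,
    [/\ forall k, test_function (phi k),
        intpow p (fun x => u x - phi k x) @[k --> \oo] --> 0%E &
        intpow p (fun x => enorm (g x - gradient (phi k) x)) @[k --> \oo]
          --> 0%E].

Definition rayleigh p u g : R :=
  fine (intpow p (fun x => enorm (g x))) / fine (intpow p u).

End sobolev.

(** Elements of W_0^{1,p} are functions up to equality almost everywhere. *)
Definition lambda1 (R : realType) (n : nat) (p : R) (Omega : set 'rV[R]_n) : R :=
  inf [set q : R | exists u g,
    [/\ W01p Omega p u g,
        ~ {ae lebesgue_rV n, forall x, Omega x -> u x = 0} &
        q = rayleigh Omega p u g]].

Definition non_monotone (R : realType) (D : set R) (f : R -> R) : Prop :=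
  ~ (forall x y, D x -> D y -> x <= y -> f x <= f y) /\
  ~ (forall x y, D x -> D y -> x <= y -> f y <= f x).

(* Main.v *)
Require Import Defs.
From mathcomp Require Import all_boot all_order all_algebra.
From mathcomp Require Import all_classical all_reals all_analysis.
From mathcomp Require Import measurable_realfun.
From mathcomp Require Import ring lra.

Set Implicit Arguments.
Unset Strict Implicit.
Unset Printing Implicit Defensive.

Import Order.TTheory GRing.Theory Num.Theory.
Import numFieldTopology.Exports numFieldNormedType.Exports.

Local Open Scope classical_set_scope.
Local Open Scope ring_scope.

(** Write L(p) for the first eigenvalue of Omega.  For a fixed test function the
    Rayleigh quotient is continuous in p, down to p = 1, and by density L(p) is
    the infimum of these quotients ([lambda1_lt], [lambda1_lt_test]).  An
    infimum of continuous functions is upper semicontinuous, so L attains a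
    maximum on every compact subinterval of ]1, +oo[ ([usc_attains_max]).  It
    remains to find a number Y and an exponent p0 > 1 with Y <= L(p0) and
    L(p) < Y both for p close to 1 and for large p; this also shows that L is
    not monotone.

    Lower bound at p0.  If a vector field F satisfies
    div F - (p - 1) |F|^(p/(p-1)) >= Lam on Omega, then integrating
    div (|phi|^p F) = 0 and applying Young's inequality gives
    Lam \int |phi|^p <= \int |grad phi|^p ([vector_field_bound]).  The field
    - |grad v|^(p-2) grad v / v^(p-1), where v is the solution of
    - Delta_p v = 1 in a ball of radius R1 slightly larger than Rad, yields
    Lam = N (p/(p-1))^(p-1) R1^(-p) ([ball_energy_bound]).  With s = ln R1, one
    of the exponents 1/(1-s) and 1/s makes this larger than N/r as soon as
    e s < r and 1 < r ([exponent_choice]).  Call this value Y.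

    Exponents close to 1.  Let phi be radially decreasing about c, supported
    in the ball of radius r and constant on the ball of radius a < r.
    Integrating div (phi(x) (x - c)) = 0 gives
    N \int phi = \int |grad phi| |x - c| >= a \int |grad phi|, so that the
    quotient at p = 1 is at most N/a ([step_energy]), which is less than Y
    when a is close to r; this persists for p near 1.

    Large exponents.  As r > 1, some test function has |grad phi| <= 1 and
    phi(c) > 1 ([slope_test_function]); then \int |grad phi|^p stays bounded
    while \int |phi|^p grows geometrically ([slope_energy_lt]). *)

(** * Row vectors: coordinates and Borel sets *)

Section row_topology.
Context {R : realType}.

Lemma rV_ballP n (x : 'rV[R]_n) (e : R) (y : 'rV[R]_n) :
  ball x e y <-> 0 < e /\ forall i, `|x ord0 i - y ord0 i| < e.
Proof.
split=> -[e0 h]; split => // i.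
- exact: h.
- by move=> j; rewrite (ord1 i); exact: h.
Qed.

Lemma continuous_rV (T : topologicalType) n (f : T -> 'rV[R]_n) (t : T) :
  (forall i, f s ord0 i @[s --> t] --> f t ord0 i) ->
  {for t, continuous f}.
Proof.
move=> cf; apply/cvg_ballP => e e0.
have : \forall s \near t, forall i, `|f t ord0 i - f s ord0 i| < e.
  apply: filter_forall => i.
  by have /cvgrPdist_lt /(_ _ e0) := cf i.
by apply: filterS => s hs; apply/rV_ballP.
Qed.

(** The sigma-algebra of ['rV_n] is generated by the coordinates, so measurability
    of an open set comes from writing it as the countable union of the boxes with
    rational centre and radius [1/(k+1)] that it contains. *)
Lemma open_rV_measurable n (A : set 'rV[R]_n) : open A -> measurable A.
Proof.
move=> oA.
pose box (q : 'rV[rat]_n * nat) : set 'rV[R]_n :=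
  ball (map_mx (@ratr R) q.1) (q.2.+1%:R^-1).
have mbox q : measurable (box q).
  have -> : box q = \bigcap_(i in [set: 'I_n])
      (@rV_coord R n i @^-1` (ball (ratr (q.1 ord0 i) : R) (q.2.+1%:R^-1))).
    apply/seteqP; split => x /=.
      by move=> /rV_ballP[_ h] i _; have := h i; rewrite mxE.
    move=> h; apply/rV_ballP; split; first by rewrite invr_gt0.
    by move=> i; rewrite mxE; exact: h.
  apply: fin_bigcap_measurable; first exact: finite_finset.
  move=> i _; rewrite -[X in measurable X]setTI; apply: measurable_rV_coord => //.
  by apply: open_measurable; exact: ball_open.
have -> : A = \bigcup_k (if (unpickle k : option ('rV[rat]_n * nat)) is Some q
    then (if `[< box q `<=` A >] then box q else set0) else set0).
  apply/seteqP; split => x; last first.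
    by move=> [k _]; case: unpickle => // q; case: asboolP => // + xq; apply.
  move=> Ax; have /nbhs_ballP[e /= e0 xeA] : nbhs x A by exact/open_nbhs_nbhs.
  have [k ke] : exists k, k.+1%:R^-1 < e / 2.
    have := @near_infty_natSinv_lt R (PosNum (divr_gt0 e0 (ltr0n _ 2))).
    by case=> k _ /(_ k (leqnn k)); exists k.
  have k0 : (0 : R) < k.+1%:R^-1 by rewrite invr_gt0.
  have [q qx] : exists q : 'rV[rat]_n,
      forall i, `|ratr (q ord0 i) - x ord0 i| < k.+1%:R^-1.
    have /choice[g gP] : forall i, exists q : rat,
        `|ratr q - x ord0 i| < k.+1%:R^-1.
      move=> i; have [//|q] := @rat_in_itvoo R (x ord0 i - k.+1%:R^-1) (x ord0 i + k.+1%:R^-1).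
        by rewrite ltrD2l gt0_cp.
      rewrite in_itv/= => /andP[q1 q2]; exists q.
      by rewrite ltr_distl q1 q2.
    by exists (\row_i g i) => i; rewrite mxE.
  exists (pickle (q, k)) => //; rewrite pickleK.
  have bqk : box (q, k) `<=` A.
    move=> y /ball_sym yq; apply: xeA.
    apply: (@ball_split _ _ (map_mx (@ratr R) q)).
      by apply/ball_sym/rV_ballP; split=> [|i]; rewrite ?divr_gt0// mxE (lt_trans (qx i)).
    by apply/ball_sym; apply: le_ball yq; exact: ltW.
  case: asboolP => // _; apply/rV_ballP; split => // i; rewrite mxE; exact: qx.
by apply: bigcupT_measurable => k; case: unpickle => // q; case: ifP.
Qed.
End row_topology.

(** * Lebesgue measure on row vectors *)

Section lebesgue_rV_theory.
Context {R : realType}.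
Local Notation mu := (@lebesgue_rV R).

Lemma rV_cons0 n (z : R * 'rV[R]_n) : rV_cons z ord0 ord0 = z.1.
Proof. by rewrite mxE unlift_none. Qed.

Lemma rV_consS n (z : R * 'rV[R]_n) j : rV_cons z ord0 (lift ord0 j) = z.2 ord0 j.
Proof. by rewrite mxE liftK. Qed.

(** Balls of the norm of ['rV_n] are cubes, hence products in the decomposition
    [rV_cons] by which the measure is built. *)
Lemma rV_cons_ball n (c : 'rV[R]_n.+1) (e : R) (z : R * 'rV[R]_n) :
  ball c e (rV_cons z) <->
  ball (c ord0 ord0) e z.1 /\ ball (\row_j c ord0 (lift ord0 j) : 'rV_n) e z.2.
Proof.
split.
  move=> /rV_ballP[e0 h]; split; first by have := h ord0; rewrite rV_cons0.
  by apply/rV_ballP; split => // j; have := h (lift ord0 j); rewrite rV_consS mxE.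
move=> [h0 /rV_ballP[e0 h]]; apply/rV_ballP; split => // i.
have [j ->|->] := unliftP ord0 i; last by rewrite rV_cons0.
by have := h j; rewrite rV_consS mxE.
Qed.

Lemma lebesgue_rV_ball n (c : 'rV[R]_n) (e : R) : 0 < e ->
  mu n (ball c e) = ((2 * e) ^+ n)%:E.
Proof.
move=> e0; elim: n c => [|n IH] c.
  by rewrite expr0 /= diracE mem_set//; apply/rV_ballP; split => // -[].
pose c' : 'rV[R]_n := \row_j c ord0 (lift ord0 j).
have -> : mu n.+1 (ball c e) =
    (lebesgue_measure \x mu n)%E (ball (c ord0 ord0) e `*` ball c' e).
  rewrite /= /leb_cons /pushforward; congr (_ _).
  by apply/seteqP; split => z /rV_cons_ball.
rewrite product_measure1E; last 2 first.
  by apply: open_measurable; exact: ball_open.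
  by apply: open_rV_measurable; exact: ball_open.
rewrite IH exprS EFinM; congr (_ * _)%E.
by rewrite [2 * e]mulr_natl; exact: (lebesgue_measure_ball (c ord0 ord0) (ltW e0)).
Qed.

(** An open set contains a ball, and a ball has positive measure. *)
Lemma lebesgue_rV_open_gt0 n (A : set 'rV[R]_n) (x : 'rV[R]_n) :
  open A -> A x -> (0 < mu n A)%E.
Proof.
move=> oA Ax; have /nbhs_ballP[e /= e0 xeA] : nbhs x A by exact/open_nbhs_nbhs.
have mb : measurable (ball x e : set 'rV[R]_n).
  by apply: open_rV_measurable; exact: ball_open.
apply: (@lt_le_trans _ _ (mu n (ball x e))); last first.
  by apply: le_measure; rewrite ?inE//; exact: open_rV_measurable.
by rewrite lebesgue_rV_ball// lte_fin exprn_gt0// mulr_gt0.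
Qed.

Lemma continuous_rV_measurable n (f : 'rV[R]_n -> R) :
  continuous f -> measurable_fun setT f.
Proof.
move=> /continuousP cf; apply: (measurability _ (RGenOpens.measurableE R)).
move=> _ [_ [a [b ->] <-]]; rewrite setTI; apply: open_rV_measurable.
exact/cf/interval_open.
Qed.

(** Continuous functions with bounded support: the class in which every integral
    below is finite and Fubini's theorem applies. *)
Definition Cc n (f : 'rV[R]_n -> R) : Prop :=
  continuous f /\ exists2 M, 0 < M & forall x, ~ ball 0 M x -> f x = 0.

Lemma cc_bounded n (f : 'rV[R]_n -> R) : Cc f ->
  exists2 C, 0 <= C & forall x, `|f x| <= C.
Proof.
move=> [cf [M M0 fM]].
pose K : set 'rV[R]_n := [set x | `|x| <= M].
have cK : compact K.
  apply: bounded_closed_compact.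
    exists M; split; first exact: num_real.
    by move=> y My x Kx; exact: (le_trans Kx (ltW My)).
  rewrite (_ : K = (fun x : 'rV[R]_n => `|x|) @^-1` [set y | y <= M])//.
  apply: closed_comp; last exact: closed_le.
  by move=> x _; exact: norm_continuous.
have [B [_ hB]] : bounded_set (f @` K).
  apply: compact_bounded; apply: continuous_compact => //.
  exact: continuous_subspaceT.
exists (`|B| + 1) => [|x]; first by rewrite addr_ge0.
have [Kx|nKx] := boolP (`|x| <= M).
  by apply: (hB (`|B| + 1)); [rewrite (le_lt_trans (ler_norm _))// ltrDl|exists x].
rewrite fM ?normr0 ?addr_ge0//; rewrite -ball_normE/= sub0r normrN.
by apply/negP; rewrite -leNgt ltW// ltNge.
Qed.

Lemma cc_integrable n (f : 'rV[R]_n -> R) : Cc f ->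
  (mu n).-integrable setT (EFin \o f).
Proof.
move=> ccf; have [cf [M M0 fM]] := ccf.
have [C C0 fC] := cc_bounded ccf.
have mB : measurable (ball (0 : 'rV[R]_n) M).
  by apply: open_rV_measurable; exact: ball_open.
have foo : (mu n (ball (0%R : 'rV[R]_n) M) < +oo)%E.
  by rewrite lebesgue_rV_ball// ltry.
have -> : EFin \o f = (EFin \o f) \_ (ball (0 : 'rV[R]_n) M).
  apply/funext => x; rewrite patchE; case: ifPn => //=.
  by rewrite notin_setE => /fM ->.
apply/integrable_restrict => //; rewrite setTI.
apply: measurable_bounded_integrable => //.
- by apply: measurable_funTS; exact: continuous_rV_measurable.
- exists C; split; first exact: num_real.
  by move=> y Cy x _; rewrite /= (le_trans (fC x))// ltW.
Qed.

(** Fixing the first coordinate keeps the class, which is what the induction on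
    the dimension in [integral_partial] needs. *)
Lemma cc_slice n (f : 'rV[R]_n.+1 -> R) (a : R) : Cc f ->
  Cc (fun v : 'rV[R]_n => f (rV_cons (a, v))).
Proof.
move=> [cf [M M0 fM]]; split.
  move=> v; apply: continuous_comp; last exact: cf.
  apply: continuous_rV => i; have [j ->|->] := unliftP ord0 i.
    rewrite rV_consS; under eq_fun do rewrite rV_consS/=.
    exact: coord_continuous.
  rewrite rV_cons0; under eq_fun do rewrite rV_cons0/=.
  refine (@cvg_cst R a _ (nbhs v) _).
exists M => // v nv; apply: fM => /rV_cons_ball[_] h; apply: nv.
by move/rV_ballP : h => [_ h]; apply/rV_ballP; split => // i; have := h i; rewrite !mxE.
Qed.

Lemma cc_fubini n (f : 'rV[R]_n.+1 -> R) : Cc f ->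
  (\int[mu n.+1]_x (f x)%:E =
     \int[lebesgue_measure]_a \int[mu n]_v (f (rV_cons (a, v)))%:E)%E /\
  (\int[mu n.+1]_x (f x)%:E =
     \int[mu n]_v \int[lebesgue_measure]_a (f (rV_cons (a, v)))%:E)%E.
Proof.
move=> ccf; have := cc_integrable ccf; have [cf _] := ccf.
move=> intf.
have mf : measurable_fun setT (EFin \o f).
  by apply/measurable_EFinP; exact: continuous_rV_measurable.
have mc := @measurable_rV_cons R n.
have mabs : measurable_fun setT (fun x : 'rV[R]_n.+1 => `|f x|%:E).
  apply/measurable_EFinP; apply: measurableT_comp => //.
  exact: continuous_rV_measurable.
have intf' : (lebesgue_measure \x mu n)%E.-integrable setT
    ((EFin \o f) \o (@rV_cons R n)).
  move/integrableP : intf => [_ foo]; apply/integrableP; split.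
    exact: measurableT_comp.
  by move: foo; rewrite /= /leb_cons ge0_integral_pushforward.
rewrite /= /leb_cons integral_pushforward// preimage_setT; split.
  by rewrite -integral12_prod_meas1.
by rewrite -integral21_prod_meas1.
Qed.

End lebesgue_rV_theory.

(** * The integral of a partial derivative *)

Section divergence.
Context {R : realType}.
Local Notation mu := (@lebesgue_rV R).

Lemma rV_ext n (u v : 'rV[R]_n) : (forall i, u ord0 i = v ord0 i) -> u = v.
Proof. by move=> uv; apply/rowP. Qed.

(** A directional derivative depends only on the restriction of the function to a
    line; this moves derivatives between a function and its slices. *)
Lemma is_derive_line (V W : normedModType R) (f : V -> R) (g : W -> R)
    (x v : V) (y w : W) (d : R) :
  (forall h : R, g (h *: w + y) = f (h *: v + x)) ->
  is_derive x v f d -> is_derive y w g d.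
Proof.
move=> gf [fx fd].
have gf0 : g y = f x by have := gf 0; rewrite !scale0r !add0r.
have E : (fun h => h^-1 *: ((g \o shift y) (h *: w) - g y)) =
         (fun h => h^-1 *: ((f \o shift x) (h *: v) - f x)).
  by apply/funext => h /=; rewrite gf gf0.
by split; [rewrite /derivable E|rewrite -fd /derive E].
Qed.

Lemma is_derive_unique (V : normedModType R) (f : V -> R) (x v : V) (a b : R) :
  is_derive x v f a -> is_derive x v f b -> a = b.
Proof. by move=> [_ <-] [_ <-]. Qed.

(** Off the support the function vanishes on a whole neighbourhood, so its
    derivative vanishes there too. *)
Lemma cc_partial n (i : 'I_n) (G dG : 'rV[R]_n -> R) : Cc G ->
  (forall x, is_derive x (delta_mx ord0 i) G (dG x)) -> continuous dG -> Cc dG.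
Proof.
move=> [cG [M M0 GM]] dGE cdG; split => //.
exists (M + 1) => [|x xM]; first by rewrite addr_gt0.
apply: (is_derive_unique (dGE x)).
apply: (near_eq_is_derive _ (is_derive_cst 0 _ _)).
apply/nbhs_ballP; exists 1 => //= y xy; apply/esym/GM => yM; apply: xM.
by apply: ball_triangle yM _; exact: ball_sym.
Qed.

Lemma integral_derive_cs (f df : R -> R) (M : R) : 0 < M ->
  (forall t : R, is_derive t 1 f (df t)) -> continuous df ->
  (forall t, M <= `|t| -> f t = 0) -> (forall t, M <= `|t| -> df t = 0) ->
  (\int[lebesgue_measure]_t (df t)%:E = 0)%E.
Proof.
move=> M0 fdf cdf f0 df0.
have E : (fun t => (df t)%:E) = (EFin \o df) \_ `[- M, M].
  apply/funext => t; rewrite patchE; case: ifPn => //=.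
  by rewrite notin_setE/= in_itv/= -ler_norml => /negP; rewrite -ltNge => /ltW/df0 ->.
have nM : - M < M by rewrite gtrN.
rewrite E -integral_mkcond/=.
rewrite (@continuous_FTC2 _ df f)//.
- by rewrite !f0 ?subee// ?normrN ger0_norm// ltW.
- exact: continuous_subspaceT.
- have cf t : {for t, continuous f}.
    by apply/differentiable_continuous/derivable1_diffP; have [] := fdf t.
  split.
  + by move=> t _; have [] := fdf t.
  + by apply: cvg_at_right_filter; exact: cf.
  + by apply: cvg_at_left_filter; exact: cf.
- by move=> t _; rewrite derive1E; have [_] := fdf t.
Qed.

(** Induction on the dimension, one coordinate being integrated at a time.  For the
    first coordinate the inner integral is that of the derivative of a function on
    the line with bounded support; for the others the induction hypothesis applies
    to the slices. *)
Theorem integral_partial n (i : 'I_n) (G dG : 'rV[R]_n -> R) : Cc G ->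
  (forall x, is_derive x (delta_mx ord0 i) G (dG x)) -> continuous dG ->
  (\int[mu n]_x (dG x)%:E = 0)%E.
Proof.
elim: n i G dG => [[]//|n IH] i G dG ccG dGE cdG.
have ccd := cc_partial ccG dGE cdG.
have [F1 F2] := cc_fubini ccd.
have [j ij|i0] := unliftP ord0 i; rewrite ?ij ?i0 in dGE.
- rewrite F1; apply: integral0_eq => a _.
  apply: (IH j (fun v => G (rV_cons (a, v))) (fun v => dG (rV_cons (a, v)))).
  + exact: cc_slice.
  + move=> v; apply: is_derive_line (dGE _) => h; congr G.
    apply: rV_ext => k; have [l ->|->] := unliftP ord0 k.
      by rewrite rV_consS !mxE/= liftK (inj_eq lift_inj).
    by rewrite rV_cons0 !mxE/= unlift_none/= mulr0 add0r.
  + by have [] := cc_slice a ccd.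
rewrite F2; apply: integral0_eq => v _.
have out M (t : R) : M <= `|t| -> ~ ball (0 : 'rV[R]_n.+1) M (rV_cons (t, v)).
  move=> nt /rV_ballP[_ /(_ ord0)]; rewrite rV_cons0 mxE/= sub0r normrN.
  by rewrite ltNge nt.
have [_ [M M0 GM]] := ccG; have [_ [M' M0' dGM]] := ccd.
apply: (@integral_derive_cs (fun a => G (rV_cons (a, v))) _ (Num.max M M')).
- by rewrite lt_max M0.
- move=> a; apply: is_derive_line (dGE _) => h; congr G.
  apply: rV_ext => k; have [l ->|->] := unliftP ord0 k.
    by rewrite rV_consS !mxE/= liftK mulr0 add0r.
  by rewrite rV_cons0 !mxE/= unlift_none/= mulr1 [h%:A]mulr1.
- move=> a; apply: continuous_comp; last exact: cdG.
  apply: continuous_rV => k; have [l ->|->] := unliftP ord0 k.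
    rewrite rV_consS; under eq_fun do rewrite rV_consS/=.
    exact: (@cvg_cst R (v ord0 l) _ (nbhs a) _).
  rewrite rV_cons0; under eq_fun do rewrite rV_cons0/=.
  exact: cvg_id.
- by move=> t; rewrite ge_max => /andP[Mt _]; exact/GM/out.
- by move=> t; rewrite ge_max => /andP[_ Mt]; exact/dGM/out.
Qed.
End divergence.

(** * Powers of absolute values *)

Section power.
Context {R : realType}.

Lemma is_derive_comp (V : normedModType R) (f : V -> R) (g : R -> R) (x v : V)
    (d e : R) :
  is_derive x v f d -> is_derive (f x) 1 g e -> is_derive x v (g \o f) (e * d).
Proof.
move=> fd ge.
have fd0 : is_derive (0 : R) (1 : R) (fun h : R => f (h *: v + x)) d.
  by apply: is_derive_line fd => h; rewrite addr0 [h%:A]mulr1.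
have ge0 : is_derive ((fun h : R => f (h *: v + x)) (0 : R)) (1 : R) g e.
  by rewrite scale0r add0r.
apply: (is_derive_line _ (is_derive1_comp ge0 fd0)) => h /=.
by rewrite addr0 [h%:A]mulr1.
Qed.

Lemma continuous_powR (p a : R) : 0 < a -> {for a, continuous (@powR R ^~ p)}.
Proof.
move=> a0; apply/differentiable_continuous/derivable1_diffP.
by apply: derivable_powR; rewrite in_itv/= a0.
Qed.

Lemma cvg_normr_powR0 (p : R) : 0 < p -> `|t| `^ p @[t --> (0 : R)] --> (0 : R).
Proof.
move=> p0; apply/cvgr0Pnorm_lt => e e0.
exists (e `^ p^-1) => /=; first exact: powR_gt0.
move=> t /=; rewrite sub0r normrN => te.
rewrite ger0_norm ?powR_ge0//.
rewrite [ltRHS](_ : e = (e `^ p^-1) `^ p); last first.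
  by rewrite -powRrM mulVf ?gt_eqF// powRr1// ltW.
by rewrite gt0_ltr_powR// ?nnegrE// powR_ge0.
Qed.

Lemma normr_powR0 (p : R) : 0 < p -> `|0 : R| `^ p = 0.
Proof. by move=> p0; rewrite normr0 powR0// gt_eqF. Qed.

Lemma continuous_normr_powR (p : R) : 0 < p ->
  continuous (fun t : R => `|t| `^ p).
Proof.
move=> p0 t; have [->|t0] := eqVneq t 0.
  by rewrite /continuous_at normr_powR0//; exact: cvg_normr_powR0.
apply: (@continuous_comp _ _ _ (fun t : R => `|t|) (@powR R ^~ p)).
  exact: norm_continuous.
by apply: continuous_powR; rewrite normr_gt0.
Qed.

(** The derivative of [`|t| `^ p], divided by [p]. *)
Definition spow (p t : R) : R := Num.sg t * `|t| `^ (p - 1).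

Lemma normr_spow p t : 1 < p -> `|spow p t| = `|t| `^ (p - 1).
Proof.
move=> p1; rewrite /spow normrM normr_sg (ger0_norm (powR_ge0 _ _)).
have [->|] := eqVneq t 0; rewrite ?mul1r//.
by rewrite mul0r normr_powR0// subr_gt0.
Qed.

Lemma continuous_spow p : 1 < p -> continuous (spow p).
Proof.
move=> p1 t; have p10 : 0 < p - 1 by rewrite subr_gt0.
have [t0|t0|->] := ltgtP t 0.
- apply: (@cvg_trans _ ((fun s : R => - `|s| `^ (p - 1)) @ t)).
    apply: near_eq_cvg; near=> s.
    rewrite /spow ltr0_sg ?mulN1r//; near: s; exact: lt_nbhsl.
  rewrite /spow ltr0_sg// mulN1r.
  exact: (cvgN (continuous_normr_powR p10 (x:=t))).
- apply: (@cvg_trans _ ((fun s : R => `|s| `^ (p - 1)) @ t)).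
    apply: near_eq_cvg; near=> s.
    rewrite /spow gtr0_sg ?mul1r//; near: s; exact: lt_nbhsr.
  rewrite /spow gtr0_sg// mul1r.
  exact: continuous_normr_powR p10 t.
rewrite /continuous_at {2}/spow sgr0 mul0r.
apply/norm_cvg0P.
under eq_fun do rewrite normr_spow//.
exact: cvg_normr_powR0.
Unshelve. all: by end_near. Qed.

Lemma is_derive_normr_powR (p t : R) : 1 < p ->
  is_derive t 1 (fun t : R => `|t| `^ p) (p * spow p t).
Proof.
move=> p1; rewrite /spow.
have [t0|t0|->] := ltgtP t 0.
- rewrite ltr0_sg// ltr0_norm//.
  apply: (@near_eq_is_derive _ _ _ ((@powR R ^~ p) \o -%R)).
    near=> s; rewrite /= ltr0_norm//; near: s; exact: lt_nbhsl.
  have := @is_derive1_powR R p (- t); rewrite oppr_gt0 => /(_ t0) d.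
  have := is_derive1_comp d (is_deriveNid t (1 : R)).
  by rewrite mulrN1 mulN1r mulrN.
- rewrite gtr0_sg// mul1r gtr0_norm//.
  apply: (@near_eq_is_derive _ _ _ (@powR R ^~ p)).
    near=> s; rewrite gtr0_norm//; near: s; exact: lt_nbhsr.
  exact: is_derive1_powR.
rewrite sgr0 mul0r mulr0.
have p0 : 0 < p by rewrite (lt_trans _ p1).
have H : (fun h : R => h^-1 *: (((fun t : R => `|t| `^ p) \o shift (0 : R)) (h *: (1 : R)) - `|0 : R| `^ p)) @ 0^' --> (0 : R).
  apply/norm_cvg0P.
  apply: (@cvg_trans _ ((fun h : R => `|h| `^ (p - 1)) @ 0^')); last first.
    by apply: cvg_within_filter; apply: cvg_normr_powR0; rewrite subr_gt0.
  apply: near_eq_cvg; near=> h.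
  have h0 : h != 0 by near: h; exact: nbhs_dnbhs_neq.
  rewrite /= normr_powR0// subr0 addr0 [h%:A]mulr1 [_ *: _]/(_ * _).
  rewrite normrM normfV (ger0_norm (powR_ge0 _ _)).
  by rewrite powRB ?normr_eq0 ?h0 ?implybT// powRr1// mulrC.
split; first by apply/cvg_ex; exists 0.
exact/cvg_lim.
Unshelve. all: by end_near. Qed.

(** Convexity of the p-th power, applied to
    [a + b = (1 - t) * (a / (1 - t)) + t * (b / t)].  For small [t] the coefficient
    of [a] tends to 1, so the inequality can replace the triangle inequality for
    L^p norms in limit arguments. *)
Lemma powR_addl_le (p t a b : R) : 1 <= p -> 0 < t < 1 -> 0 <= a -> 0 <= b ->
  (a + b) `^ p <= (1 - t) `^ (1 - p) * a `^ p + t `^ (1 - p) * b `^ p.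
Proof.
move=> p1 /andP[t0 t1] a0 b0.
have s0 : 0 < 1 - t by rewrite subr_gt0.
have t01 : 0 <= t <= 1 by rewrite !ltW.
pose tt : {i01 R} := Itv01 (ltW t0) (ltW t1).
have := @convex_powR R p p1 tt (b / t) (a / (1 - t)).
rewrite !inE/= !in_itv/= !andbT !divr_ge0 ?(ltW t0) ?(ltW s0)// => /(_ isT isT).
rewrite [X in X `^ _ <= _ -> _]convRE convRE/= [unstable.onem t]/(1 - t).
have -> : t * (b / t) + (1 - t) * (a / (1 - t)) = a + b.
  by field; rewrite !gt_eqF.
move=> /le_trans; apply.
rewrite !powRM ?invr_ge0 ?(ltW t0) ?(ltW s0)//.
have pw u : 0 < u -> u * (u^-1) `^ p = u `^ (1 - p).
  move=> u0; rewrite powRB ?(gt_eqF u0) ?implybT// powRr1 ?ltW//; congr (_ * _).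
  by rewrite -powRN -[in RHS]mulN1r powRrM powR_inv1 ?ltW.
by rewrite addrC [b `^ p * _]mulrC [a `^ p * _]mulrC !mulrA !pw.
Qed.

(** Young's inequality for the conjugate exponents [p] and [p / (p - 1)], multiplied
    by [p]. *)
Lemma young_powR (p a b : R) : 1 < p -> 0 <= a -> 0 <= b ->
  p * (a * b) <= a `^ p + (p - 1) * b `^ (p / (p - 1)).
Proof.
move=> p1 a0 b0; have p0 : 0 < p by rewrite (lt_trans _ p1).
have p10 : 0 < p - 1 by rewrite subr_gt0.
have := @conjugate_powR R a b p (p / (p - 1)) a0 b0 p0 (divr_gt0 p0 p10).
have -> : p^-1 + (p / (p - 1))^-1 = 1 by field; rewrite !gt_eqF.
move=> /(_ erefl); rewrite -(ler_pM2l p0) => /le_trans; apply.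
by rewrite le_eqVlt; apply/orP; left; apply/eqP; field; rewrite !gt_eqF.
Qed.
End power.

(** * The Euclidean norm and the calculus of C^k functions *)

Lemma cvg_sumr (R : realType) (T I : Type) (F : set_system T) {FF : Filter F}
    (r : seq I) (f : I -> T -> R) (a : I -> R) :
  (forall i, f i t @[t --> F] --> a i) ->
  \sum_(i <- r) f i t @[t --> F] --> \sum_(i <- r) a i.
Proof.
move=> fa; elim: r => [|i r IH].
  by rewrite big_nil; under eq_fun do rewrite big_nil; exact: cvg_cst.
rewrite big_cons; under eq_fun do rewrite big_cons.
exact: cvgD.
Qed.

Section euclidean_norm.
Context {R : realType} {n : nat}.
Implicit Types x y c : 'rV[R]_n.

Lemma enorm_ge0 x : 0 <= enorm x.
Proof. exact: sqrtr_ge0. Qed.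

Lemma enorm_sqr x : enorm x ^+ 2 = \sum_i x ord0 i ^+ 2.
Proof. by rewrite sqr_sqrtr// sumr_ge0// => i _; rewrite sqr_ge0. Qed.

Lemma le_coord_enorm x i : `|x ord0 i| <= enorm x.
Proof.
rewrite -sqrtr_sqr ler_sqrt ?sumr_ge0// => [|j _]; last exact: sqr_ge0.
by rewrite (bigD1 i)//= lerDl sumr_ge0// => j _; rewrite sqr_ge0.
Qed.

Lemma enorm_eq0 x i : enorm x = 0 -> x ord0 i = 0.
Proof.
by move=> x0; apply/eqP; rewrite -normr_le0 -x0; exact: le_coord_enorm.
Qed.

Lemma enorm0 : enorm (0 : 'rV[R]_n) = 0.
Proof.
by rewrite /enorm big1 ?sqrtr0// => i _; rewrite mxE expr0n.
Qed.

Lemma enormZ a x : enorm (a *: x) = `|a| * enorm x.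
Proof.
rewrite -sqrtr_sqr -sqrtrM ?sqr_ge0// mulr_sumr.
by congr (Num.sqrt _); apply: eq_bigr => i _; rewrite mxE exprMn.
Qed.

(** Sum the inequalities
    [x_i y_i <= (b / a) x_i ^ 2 / 2 + (a / b) y_i ^ 2 / 2] with [a] and [b] the norms
    of [x] and [y]. *)
Lemma cauchy_schwarz x y :
  \sum_i x ord0 i * y ord0 i <= enorm x * enorm y.
Proof.
have [x0|x0] := eqVneq (enorm x) 0.
  by rewrite x0 mul0r big1// => i _; rewrite enorm_eq0 ?mul0r.
have [y0|y0] := eqVneq (enorm y) 0.
  by rewrite y0 mulr0 big1// => i _; rewrite [y _ _]enorm_eq0 ?mulr0.
have xp : 0 < enorm x by rewrite lt0r x0 enorm_ge0.
have yp : 0 < enorm y by rewrite lt0r y0 enorm_ge0.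
set a := enorm x in x0 xp *; set b := enorm y in y0 yp *.
apply: (@le_trans _ _ (\sum_i (b / a / 2 * x ord0 i ^+ 2 + a / b / 2 * y ord0 i ^+ 2))).
  apply: ler_sum => i _; rewrite -subr_ge0.
  rewrite (_ : _ - _ = (b * x ord0 i - a * y ord0 i) ^+ 2 / (2 * a * b)).
    by rewrite divr_ge0 ?sqr_ge0// !mulr_ge0// ltW.
  by field; rewrite ?x0 ?y0.
rewrite big_split/= -!mulr_sumr -!enorm_sqr -/a -/b.
by rewrite le_eqVlt; apply/orP; left; apply/eqP; field; rewrite ?x0 ?y0.
Qed.

Lemma enormD x y : enorm (x + y) <= enorm x + enorm y.
Proof.
rewrite -(@ler_pXn2r _ 2)// ?nnegrE ?addr_ge0 ?enorm_ge0//.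
rewrite sqrrD !enorm_sqr -!enorm_sqr.
have -> : enorm (x + y) ^+ 2 =
    enorm x ^+ 2 + (\sum_i x ord0 i * y ord0 i) *+ 2 + enorm y ^+ 2.
  rewrite !enorm_sqr -sumrMnl -!big_split/=; apply: eq_bigr => i _.
  by rewrite mxE sqrrD.
by rewrite lerD2r lerD2l lerMn2r cauchy_schwarz orbT.
Qed.

Lemma enormN x : enorm (- x) = enorm x.
Proof. by rewrite -scaleN1r enormZ normrN1 mul1r. Qed.

Lemma continuous_enorm_comp (T : topologicalType) (g : T -> 'rV[R]_n) (t : T) :
  (forall i, g s ord0 i @[s --> t] --> g t ord0 i) ->
  enorm (g s) @[s --> t] --> enorm (g t).
Proof.
move=> cg; apply: (@continuous_cvg _ _ _ _ _ _ (@Num.sqrt R)).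
  exact: sqrt_continuous.
by apply: cvg_sumr => i; apply: cvgM; exact: cg.
Qed.

Lemma measurable_enorm d (T : measurableType d) (D : set T) (g : T -> 'rV[R]_n) :
  (forall i, measurable_fun D (fun t => g t ord0 i)) ->
  measurable_fun D (fun t => enorm (g t)).
Proof.
move=> mg; apply: (measurableT_comp (continuous_measurable_fun (@sqrt_continuous R))).
by apply: measurable_sum => i; exact: measurable_funX.
Qed.

(** The square of the distance is a polynomial, so radial functions written in terms
    of it are differentiable at their centre as well. *)
Definition sqdist c x : R := \sum_i (x ord0 i - c ord0 i) ^+ 2.

Lemma sqdistE c x : sqdist c x = enorm (x - c) ^+ 2.
Proof. by rewrite enorm_sqr; apply: eq_bigr => i _; rewrite !mxE. Qed.

Lemma is_derive_coord (i j : 'I_n) x :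
  is_derive x (delta_mx ord0 i) (fun x : 'rV[R]_n => x ord0 j) (i == j)%:R.
Proof.
pose b : R := (i == j)%:R.
have d : is_derive (0 : R) (1 : R) (fun h : R => h * b + x ord0 j) b.
  apply: is_derive_eq.
  by rewrite scale0r add0r addr0 [b%:A]mulr1.
apply: is_derive_line d => h.
by rewrite !mxE/= addr0 [h%:A]mulr1 eq_sym.
Qed.

Lemma is_derive_sqdist c (i : 'I_n) x :
  is_derive x (delta_mx ord0 i) (sqdist c) (2 * (x ord0 i - c ord0 i)).
Proof.
have -> : sqdist c = \sum_j (fun x : 'rV[R]_n => (x ord0 j - c ord0 j) ^+ 2).
  by apply/funext => y; rewrite fct_sumE.
have d j : is_derive x (delta_mx ord0 i)
    (fun x : 'rV[R]_n => (x ord0 j - c ord0 j) ^+ 2)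
    (2 * (x ord0 j - c ord0 j) * (i == j)%:R).
  have d1 : is_derive (x ord0 j) (1 : R) (fun t : R => (t - c ord0 j) ^+ 2)
      (2 * (x ord0 j - c ord0 j)).
    apply: is_derive_eq.
    by rewrite subr0 [_ *: 1]mulr1 mulr_natl mulr2n.
  exact: is_derive_comp (is_derive_coord i j x) d1.
rewrite (_ : 2 * _ = \sum_j 2 * (x ord0 j - c ord0 j) * (i == j)%:R).
  exact: is_derive_sum.
rewrite (bigD1 i)//= big1 => [|j ji]; first by rewrite eqxx mulr1 addr0.
by rewrite eq_sym (negbTE ji) mulr0.
Qed.

End euclidean_norm.

Section smooth_functions.
Context {R : realType}.

(** C^k regularity on [D] of a function of one variable.  The derivative is only
    asked to exist on [D], so that powers, which are regular on the positive reals,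
    can be composed with functions with positive values. *)
Fixpoint C1d (D : set R) (k : nat) (g : R -> R) : Prop :=
  (forall t, D t -> {for t, continuous g}) /\
  if k is k'.+1 then
    exists2 dg, (forall t, D t -> is_derive t (1 : R) g (dg t)) & C1d D k' dg
  else True.

Lemma C1d_continuous D k g t : C1d D k g -> D t -> {for t, continuous g}.
Proof. by case: k => [|k] [+ _]; apply. Qed.

Lemma C1dS D k g dg : (forall t, D t -> is_derive t (1 : R) g (dg t)) ->
  C1d D k dg -> C1d D k.+1 g.
Proof.
move=> gdg cdg; split; last by exists dg.
move=> t Dt; apply/differentiable_continuous/derivable1_diffP.
by have [] := gdg t Dt.
Qed.

Lemma C1d_lin D k (a b : R) f g : C1d D k f -> C1d D k g ->
  C1d D k (fun t => a * f t + b * g t).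
Proof.
elim: k f g => [|k IH] f g [cf hf] [cg hg].
  split => // t Dt; apply: cvgD; apply: cvgM; try exact: cvg_cst.
    exact: cf.
  exact: cg.
have [df fdf cdf] := hf; have [dg gdg cdg] := hg.
apply: (C1dS (dg := fun t => a * df t + b * dg t)); last exact: IH.
move=> t Dt; have fd := fdf t Dt; have gd := gdg t Dt.
exact: (is_deriveD (is_deriveZ a fd) (is_deriveZ b gd)).
Qed.

Context {n : nat}.
Implicit Types f g : 'rV[R]_n -> R.

Lemma Ck_continuous k f : Ck k f -> continuous f.
Proof. by case: k => [|k] []. Qed.

Lemma Ck_is_derive k f i x : Ck k.+1 f ->
  is_derive x (delta_mx ord0 i) f (partial i f x).
Proof. by move=> [_ /(_ i)[df _]]; exact: derivableP. Qed.

Lemma is_derive_partial f i (df : 'rV[R]_n -> R) :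
  (forall x, is_derive x (delta_mx ord0 i) f (df x)) -> partial i f = df.
Proof. by move=> fdf; apply/funext => x; have [_] := fdf x. Qed.

(** Explicit derivatives determine the operator [partial], so regularity can be
    proved by exhibiting them. *)
Lemma Ck_succ k f (df : 'I_n -> 'rV[R]_n -> R) : continuous f ->
  (forall i x, is_derive x (delta_mx ord0 i) f (df i x)) ->
  (forall i, Ck k (df i)) -> Ck k.+1 f.
Proof.
move=> cf fdf cdf; split => // i; split; first by move=> x; have [] := fdf i x.
by rewrite (is_derive_partial (fdf i)).
Qed.

Lemma Ck_pred k f : Ck k.+1 f -> Ck k f.
Proof.
elim: k f => [|k IH] f [cf hf]; split => // i.
by have [df cdf] := hf i; split => //; exact: IH.
Qed.

Lemma Ck_cst k (a : R) : Ck k (fun _ : 'rV[R]_n => a).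
Proof.
elim: k a => [|k IH] a; first by split => // x; exact: (@cvg_cst R a _ (nbhs x) _).
apply: (Ck_succ (df := fun _ _ => 0)) => [x|i]; last exact: IH.
exact: (@cvg_cst R a _ (nbhs x) _).
Qed.

Lemma Ck_coord k j : Ck k (fun x : 'rV[R]_n => x ord0 j).
Proof.
case: k => [|k]; first by split => //; exact: coord_continuous.
apply: (Ck_succ (df := fun i _ => (i == j)%:R)); first exact: coord_continuous.
  by move=> i x; exact: is_derive_coord.
by move=> i; exact: Ck_cst.
Qed.

Lemma Ck_add k f g : Ck k f -> Ck k g -> Ck k (fun x => f x + g x).
Proof.
elim: k f g => [|k IH] f g hf hg.
  split => // x; exact: (cvgD (Ck_continuous hf (x:=x)) (Ck_continuous hg (x:=x))).
apply: (Ck_succ (df := fun i x => partial i f x + partial i g x)).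
- move=> x; exact: (cvgD (Ck_continuous hf (x:=x)) (Ck_continuous hg (x:=x))).
- by move=> i x; exact: (is_deriveD (Ck_is_derive i x hf) (Ck_is_derive i x hg)).
- by move=> i; apply: IH; [have [_ /(_ i)[]] := hf|have [_ /(_ i)[]] := hg].
Qed.

Lemma Ck_mul k f g : Ck k f -> Ck k g -> Ck k (fun x => f x * g x).
Proof.
elim: k f g => [|k IH] f g hf hg.
  split => // x; exact: (cvgM (Ck_continuous hf (x:=x)) (Ck_continuous hg (x:=x))).
apply: (Ck_succ (df := fun i x => f x * partial i g x + g x * partial i f x)).
- move=> x; exact: (cvgM (Ck_continuous hf (x:=x)) (Ck_continuous hg (x:=x))).
- by move=> i x; exact: (is_deriveM (Ck_is_derive i x hf) (Ck_is_derive i x hg)).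
- move=> i; have [_ /(_ i)[_ pf]] := hf; have [_ /(_ i)[_ pg]] := hg.
  by apply: Ck_add; apply: IH => //; exact: Ck_pred.
Qed.

Lemma Ck_comp (D : set R) k (g : R -> R) f : (forall x, D (f x)) ->
  C1d D k g -> Ck k f -> Ck k (g \o f).
Proof.
move=> Df; elim: k g => [|k IH] g hg hf.
  split => // x; apply: continuous_comp; first exact: (Ck_continuous hf).
  exact: (C1d_continuous hg).
have [_ [dg gdg cdg]] := hg.
apply: (Ck_succ (df := fun i x => dg (f x) * partial i f x)).
- move=> x; apply: continuous_comp; first exact: (Ck_continuous hf).
  exact: (C1d_continuous hg).
- move=> i x; exact: (is_derive_comp (Ck_is_derive i x hf) (gdg _ (Df x))).
- move=> i; have [_ /(_ i)[_ pf]] := hf.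
  by apply: (Ck_mul (f := dg \o f)) => //; apply: IH => //; exact: Ck_pred.
Qed.

Lemma Ck_sum k (I : Type) (r : seq I) (F : I -> 'rV[R]_n -> R) :
  (forall i, Ck k (F i)) -> Ck k (fun x => \sum_(i <- r) F i x).
Proof.
move=> cF; elim: r => [|i r IH].
  by under eq_fun do rewrite big_nil; exact: Ck_cst.
by under eq_fun do rewrite big_cons; exact: Ck_add.
Qed.

Lemma Ck_sqdist k (c : 'rV[R]_n) : Ck k (sqdist c).
Proof.
apply: Ck_sum => i; apply: Ck_mul; apply: Ck_add; try exact: Ck_coord; exact: Ck_cst.
Qed.

Lemma C1d_powR k (a : R) : C1d [set t | 0 < t] k (@powR R ^~ a).
Proof.
elim: k a => [|k IH] a.
  by split => // t t0; exact: continuous_powR.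
apply: (C1dS (dg := fun t => a * t `^ (a - 1) + 0 * t `^ (a - 1))); last exact: C1d_lin.
by move=> t t0; rewrite mul0r addr0; exact: is_derive1_powR.
Qed.

End smooth_functions.

(** * A flat function and two radial test functions *)

Section flat.
Context {R : realType}.
Variable kappa : R.
Hypothesis kappa_gt0 : 0 < kappa.

(** The classical smooth function vanishing on the negative reals, with an
    additional power [t `^ a]: the family obtained when [a] varies is closed under
    differentiation. *)
Definition flat (a t : R) : R :=
  if 0 < t then t `^ a * expR (- kappa * t `^ (-1)) else 0.

Lemma flat_le0 a t : t <= 0 -> flat a t = 0.
Proof. by rewrite /flat leNgt => /negbTE ->. Qed.

Lemma flatE a t : 0 < t -> flat a t = t `^ a * expR (- kappa * t `^ (-1)).
Proof. by rewrite /flat => ->. Qed.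

Lemma flat_ge0 a t : 0 <= flat a t.
Proof. by rewrite /flat; case: ifP => // _; rewrite mulr_ge0 ?powR_ge0 ?expR_ge0. Qed.

Lemma flat_gt0 a t : 0 < t -> 0 < flat a t.
Proof. by move=> t0; rewrite flatE// mulr_gt0 ?powR_gt0 ?expR_gt0. Qed.

(** Since [expR y >= y ^ m / m!], the factor [expR (- kappa / t)] is at most a multiple
    of [t ^ m]; an [m >= 2 - a] absorbs the power [t `^ a]. *)
Lemma flat_bound a : exists2 C, 0 <= C & forall t, `|t| <= 1 -> `|flat a t| <= C * t ^+ 2.
Proof.
have [m ma] : exists m, 2 - a <= m.+1%:R.
  (* any natural number beyond 2 - a will do *)
  exists (Num.bound `|2 - a|); rewrite (le_trans (ler_norm _))//.
  by rewrite (le_trans (ltW (archi_boundP (normr_ge0 (2 - a)))))// ler_nat.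
exists ((m.+1)`!%:R / kappa ^+ m.+1) => [|t t1].
  by rewrite divr_ge0// exprn_ge0// ltW.
have [t0|t0] := leP t 0.
  by rewrite flat_le0// normr0 mulr_ge0 ?sqr_ge0// divr_ge0// exprn_ge0// ltW.
rewrite ger0_norm ?flat_ge0// flatE//.
rewrite gtr0_norm// in t1.
rewrite mulNr expRN powR_inv1 ?(ltW t0)//.
have E : kappa ^+ m.+1 / (t ^+ m.+1 * (m.+1)`!%:R) <= expR (kappa / t).
  apply: le_trans (expR_ge1Dxn m (divr_ge0 (ltW kappa_gt0) (ltW t0))).
  rewrite expr_div_n invfM mulrA.
  by rewrite lerDr.
have km0 : 0 < kappa ^+ m.+1 by rewrite exprn_gt0.
have tm0 : 0 < t ^+ m.+1 by rewrite exprn_gt0.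
have f0 : (0 : R) < (m.+1)`!%:R by rewrite ltr0n fact_gt0.
apply: (@le_trans _ _ (t `^ a * (kappa ^+ m.+1 / (t ^+ m.+1 * (m.+1)`!%:R))^-1)).
  rewrite ler_wpM2l ?powR_ge0// lef_pV2 ?posrE ?expR_gt0//.
  by rewrite divr_gt0// mulr_gt0.
have -> : t `^ a * (kappa ^+ m.+1 / (t ^+ m.+1 * (m.+1)`!%:R))^-1 =
    (m.+1)`!%:R / kappa ^+ m.+1 * (t `^ a * t ^+ m.+1).
  by field; rewrite !gt_eqF.
rewrite ler_wpM2l//; first by rewrite divr_ge0// ltW.
rewrite -!powR_mulrn ?(ltW t0)// -powRD; last by rewrite (gt_eqF t0) implybT.
by apply: ger_powR; rewrite ?t0// -lerBlDl.
Qed.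

(** Away from 0 this is the product rule.  At 0 the quadratic bound [flat_bound]
    makes the difference quotient tend to 0. *)
Lemma is_derive_flat a t :
  is_derive t (1 : R) (flat a) (a * flat (a - 1) t + kappa * flat (a - 2) t).
Proof.
have [t0|t0|->] := ltgtP t 0.
- rewrite !flat_le0 ?ltW// !mulr0 addr0.
  apply: (near_eq_is_derive _ (is_derive_cst (0 : R) _ _)).
  near=> s; rewrite /= flat_le0// ltW//; near: s; exact: lt_nbhsl.
- apply: (@near_eq_is_derive _ _ _ ((@powR R ^~ a) * (fun s : R => expR (- kappa * s `^ (-1))))).
    near=> s; rewrite flatE//; near: s; exact: lt_nbhsr.
  have d1 := is_derive1_powR a t0.
  have d2 := is_deriveZ (- kappa) (is_derive1_powR (-1) t0).
  have d3 := is_derive1_comp (is_derive_expR _) d2.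
  apply: (is_derive_eq (is_deriveM d1 d3)).
  rewrite !flatE//.
  have t2 : t `^ (a - 2) = t `^ a * t `^ (-1 - 1).
    by rewrite -powRD; [congr (_ `^ _); ring|rewrite (gt_eqF t0) implybT].
  rewrite t2; set E := expR _; rewrite /GRing.scale/= -/E; ring.
rewrite !flat_le0// !mulr0 addr0.
have [C C0 fC] := flat_bound a.
have H : (fun h : R => h^-1 *: (((flat a) \o shift (0 : R)) (h *: (1 : R)) - flat a 0)) @ 0^' --> (0 : R).
  apply/cvgr0Pnorm_lt => e e0.
  near=> h.
  have h0 : h != 0 by near: h; exact: nbhs_dnbhs_neq.
  rewrite /= addr0 [h%:A]mulr1 (flat_le0 a (lexx 0)) subr0 [_ *: _]/(_ * _).
  rewrite normrM normfV mulrC ltr_pdivrMr ?normr_gt0//.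
  have h1 : `|h| <= 1 by near: h; exact: dnbhs0_le.
  apply: (le_lt_trans (fC _ h1)).
  have hC : `|h| < e / (C + 1) by near: h; apply: dnbhs0_lt; rewrite divr_gt0// ltr_wpDl.
  rewrite ltr_pdivlMr in hC; last by rewrite ltr_wpDl.
  rewrite -(@real_normK _ h) ?num_real// expr2 mulrA ltr_pM2r ?normr_gt0//.
  by apply: le_lt_trans hC; rewrite mulrDr mulr1 mulrC lerDl.
split; first by apply/cvg_ex; exists 0.
exact/cvg_lim.
Unshelve. all: by end_near. Qed.

Lemma C1d_flat k a : C1d setT k (flat a).
Proof.
elim: k a => [|k IH] a.
  split => // t _; apply/differentiable_continuous/derivable1_diffP.
  by have [] := is_derive_flat a t.
apply: (C1dS (dg := fun t => a * flat (a - 1) t + kappa * flat (a - 2) t)).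
  by move=> t _; exact: is_derive_flat.
exact: C1d_lin.
Qed.

End flat.

Section radial_test_functions.
Context {R : realType} {n : nat}.
Implicit Types (Omega : set 'rV[R]_n) (c : 'rV[R]_n).

Lemma sqdist_ge0 c x : 0 <= sqdist c x.
Proof. by rewrite sumr_ge0// => i _; rewrite sqr_ge0. Qed.

Lemma sqdist_center c : sqdist c c = 0.
Proof. by apply: big1 => i _; rewrite subrr expr0n. Qed.

Lemma sqdist_lt c (r : R) x : 0 <= r -> (sqdist c x < r ^+ 2) = (enorm (x - c) < r).
Proof. by move=> r0; rewrite sqdistE ltr_pXn2r// nnegrE enorm_ge0. Qed.

Lemma continuous_sqdist c : continuous (sqdist c).
Proof. exact: (Ck_continuous (Ck_sqdist 0 c)). Qed.

Lemma radial_test_function Omega c (b r : R) (phi : 'rV[R]_n -> R) :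
  0 <= b < r -> eball c r `<=` Omega -> smooth phi ->
  (forall x, b ^+ 2 < sqdist c x -> phi x = 0) -> test_function Omega phi.
Proof.
move=> /andP[b0 br] cO sphi phi0.
pose K : set 'rV[R]_n := [set x | sqdist c x <= b ^+ 2].
have closedK : closed K.
  rewrite (_ : K = sqdist c @^-1` [set y | y <= b ^+ 2])//.
  apply: closed_comp; last exact: closed_le.
  by move=> x _; exact: continuous_sqdist.
have suppK : closure [set x | phi x != 0] `<=` K.
  rewrite [X in _ `<=` X](closure_id K).1//; apply: closure_subset => x /= phix.
  rewrite /K/=.
  by rewrite leNgt; apply/negP => /phi0/eqP; rewrite (negbTE phix).
have r0 : 0 <= r by rewrite (le_trans b0)// ltW.
split=> //.
  apply: (subclosed_compact _ _ suppK); first exact: closed_closure.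
  apply: bounded_closed_compact => //.
  exists (`|c| + (b + 1)); split; first exact: num_real.
  move=> M hM x Kx; apply: (le_trans _ (ltW hM)).
  have /ltW cx : `|c - x| < b + 1.
    suff : ball c (b + 1) x by rewrite -ball_normE.
    apply/rV_ballP; split=> [|i]; first by rewrite ltr_wpDl.
    rewrite distrC; apply: (@le_lt_trans _ _ (enorm (x - c))).
      by have := le_coord_enorm (x - c) i; rewrite !mxE.
    rewrite -sqdist_lt ?addr_ge0//; apply: (le_lt_trans Kx).
    by rewrite ltr_pXn2r ?nnegrE ?addr_ge0// ltrDl.
  rewrite -[x](subKr c); apply: (le_trans (ler_normB _ _)).
  by rewrite lerD2l.
move=> x /suppK Kx; apply: cO; rewrite /eball/= -sqdist_lt//.
by apply: (le_lt_trans Kx); rewrite ltr_pXn2r ?nnegrE.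
Qed.

(** With [h = flat 1 0] and [m = h (b ^ 2 - a ^ 2)], [a < b < r], the function
    [h (m - h (w - a ^ 2))] of [w = |x - c| ^ 2] is non-increasing, equal to [h m] for
    [w <= a ^ 2] and to 0 for [w >= b ^ 2].  It thus plays the role of a smooth
    indicator function of the ball, and no division is involved. *)
Lemma step_test_function Omega c (a r : R) :
  0 <= a < r -> eball c r `<=` Omega ->
  exists phi g : 'rV[R]_n -> R,
    [/\ test_function Omega phi, forall x, 0 <= phi x, 0 < phi c,
     forall i x, partial i phi x = - g x * (x ord0 i - c ord0 i) &
     forall x, 0 <= g x /\ (sqdist c x < a ^+ 2 -> g x = 0)].
Proof.
move=> /andP[a0 ar] cO; pose b := (a + r) / 2.
have ab : a < b by rewrite /b; lra.
have br : b < r by rewrite /b; lra.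
have b0 : 0 <= b by rewrite (le_trans a0)// ltW.
have ab2 : 0 < b ^+ 2 - a ^+ 2 by rewrite subr_gt0 ltr_pXn2r.
pose h := flat (1 : R) 0; pose m := h (b ^+ 2 - a ^+ 2).
have hd t : is_derive t (1 : R) h (flat 1 (- 2) t).
  by apply: (is_derive_eq (is_derive_flat ltr01 0 t)); rewrite mul0r add0r mul1r sub0r.
have hmono s t : s <= t -> h s <= h t.
  move=> st; rewrite /h; have [s0|s0] := leP s 0; first by rewrite flat_le0// flat_ge0.
  have t0 := lt_le_trans s0 st.
  rewrite !flatE// !powRr0 !mul1r ler_expR !mulN1r lerN2 !powR_inv1 ?(ltW s0) ?(ltW t0)//.
  by rewrite lef_pV2.
pose H t := h (m - h (t - a ^+ 2)).
pose dH t := flat 1 (- 2) (m - h (t - a ^+ 2)) * flat 1 (- 2) (t - a ^+ 2).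
have Hd t : is_derive t (1 : R) H (- dH t).
  have d1 : is_derive t (1 : R) (fun t => t - a ^+ 2) 1.
    by apply: is_derive_eq; rewrite subr0.
  have d2 := @is_derive1_comp R h (fun t => t - a ^+ 2) t _ _ (hd _) d1.
  have d3 : is_derive t (1 : R) (fun t => m - h (t - a ^+ 2)) (- flat 1 (- 2) (t - a ^+ 2)).
    by apply: (is_derive_eq (is_deriveB (is_derive_cst m _ _) d2)); rewrite sub0r mulr1.
  by apply: (is_derive_eq (@is_derive1_comp R h _ t _ _ (hd _) d3)); rewrite mulrN.
have h0 : h (- a ^+ 2) = 0 by rewrite /h flat_le0// oppr_le0 sqr_ge0.
exists (H \o sqdist c), (fun x => 2 * dH (sqdist c x)); split.
- apply: (@radial_test_function _ c b r _ _ cO) => [||].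
    by rewrite b0.
    move=> k; refine (@Ck_comp _ _ setT k h (fun x => m - h (sqdist c x - a ^+ 2)) _ (C1d_flat ltr01 k 0) _) => //.
    rewrite (_ : (fun _ => _) = (fun x => m + (- 1) * h (sqdist c x - a ^+ 2))); last first.
      by apply/funext => x; rewrite mulN1r.
    apply: Ck_add; first exact: Ck_cst.
    apply: Ck_mul; first exact: Ck_cst.
    refine (@Ck_comp _ _ setT k h (fun x => sqdist c x - a ^+ 2) _ (C1d_flat ltr01 k 0) _) => //.
    by apply: Ck_add; [exact: Ck_sqdist|exact: Ck_cst].
  move=> x bx; rewrite /= /H /h flat_le0// subr_le0; apply: hmono.
  by rewrite lerD2r ltW.
- by move=> x; exact: flat_ge0.
- by rewrite /= /H sqdist_center sub0r h0 subr0; apply/flat_gt0/flat_gt0.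
- move=> i x; rewrite /partial; have [_ ->] := @is_derive_comp _ _ _ H x _ _ _ (is_derive_sqdist c i x) (Hd _).
  by ring.
- move=> x; split; first by rewrite !mulr_ge0// flat_ge0.
  move=> xa; have xa0 : sqdist c x - a ^+ 2 <= 0 by rewrite subr_le0 ltW.
  by rewrite /dH (flat_le0 1 (- 2) xa0) !mulr0.
Qed.

(** A smooth version of the cone [C - |x - c|]: the norm is smoothed into
    [sqrt (|x - c| ^ 2 + d ^ 2)], and the positive part into [T t = t expR (- d / t)], which
    satisfies [T' <= 1] because [1 + y <= expR y], and [T t >= t - d].  Here
    [C = 1 + 3 d < r], so the value at the centre is at least [C - d - d > 1]. *)
Lemma slope_test_function Omega c (r : R) :
  1 < r -> eball c r `<=` Omega ->
  exists phi : 'rV[R]_n -> R,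
    [/\ test_function Omega phi, forall x, enorm (gradient phi x) <= 1 & 1 < phi c].
Proof.
move=> r1 cO; pose d := (r - 1) / 4.
have d0 : 0 < d by rewrite /d; lra.
have dr : 1 + 3 * d < r by rewrite /d; lra.
pose C := 1 + 3 * d.
pose T := flat d 1; pose dT t := flat d 0 t + d * flat d (- 1) t.
have Td t : is_derive t (1 : R) T (dT t).
  apply: (is_derive_eq (is_derive_flat d0 1 t)).
  by rewrite /dT mul1r subrr; congr (_ + _ * flat _ _ _); lra.
have dT0 t : 0 <= dT t by rewrite addr_ge0 ?flat_ge0// mulr_ge0 ?flat_ge0 ?ltW.
have dT1 t : dT t <= 1.
  rewrite /dT; have [t0|t0] := leP t 0; first by rewrite !flat_le0// mulr0 addr0.
  rewrite !flatE// powRr0 mul1r mulrA -{1}[expR _]mul1r -mulrDl mulNr expRN.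
  by rewrite ler_pdivrMr ?expR_gt0// mul1r expR_ge1Dx.
have TE t : 0 < t -> t - d <= T t.
  move=> t0; rewrite /T flatE// powRr1 ?(ltW t0)// powR_inv1 ?(ltW t0)//.
  rewrite -[leLHS](_ : t * (1 + - d * t^-1) = _); last by field; rewrite gt_eqF.
  by rewrite ler_wpM2l ?(ltW t0)// expR_ge1Dx.
pose q (t : R) := t + d ^+ 2.
have q0 t : 0 <= t -> 0 < q t by move=> t0; rewrite ltr_wpDl// exprn_gt0.
pose H t := T (C - (q t) `^ 2^-1).
pose dH t := dT (C - (q t) `^ 2^-1) * (2^-1 * (q t) `^ (2^-1 - 1)).
have Hd (t : R) : 0 <= t -> is_derive t (1 : R) H (- dH t).
  move=> t0.
  have d1 : is_derive t (1 : R) q 1 by apply: is_derive_eq; rewrite addr0.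
  have d2 := @is_derive1_comp R (@powR R ^~ 2^-1) q t _ _ (is_derive1_powR 2^-1 (q0 _ t0)) d1.
  have d3 : is_derive t (1 : R) (fun t => C - (q t) `^ 2^-1) (- (2^-1 * (q t) `^ (2^-1 - 1))).
    by apply: (is_derive_eq (is_deriveB (is_derive_cst C _ _) d2)); rewrite sub0r mulr1.
  by apply: (is_derive_eq (@is_derive1_comp R T _ t _ _ (Td _) d3)); rewrite mulrN.
have C0 : 0 < C by rewrite /C; lra.
exists (H \o sqdist c); split.
- apply: (@radial_test_function _ c C r _ _ cO) => [||].
    by rewrite (ltW C0).
    move=> k; refine (@Ck_comp _ _ setT k T (fun x => C - (q (sqdist c x)) `^ 2^-1) _ (C1d_flat d0 k 1) _) => //.
    rewrite (_ : (fun _ => _) = (fun x => C + (- 1) * (q (sqdist c x)) `^ 2^-1)); last first.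
      by apply/funext => x; rewrite mulN1r.
    apply: Ck_add; first exact: Ck_cst.
    apply: Ck_mul; first exact: Ck_cst.
    refine (@Ck_comp _ _ _ k (@powR R ^~ 2^-1) (fun x => q (sqdist c x)) _ (C1d_powR k 2^-1) _).
      by move=> x; exact/q0/sqdist_ge0.
    by apply: Ck_add; [exact: Ck_sqdist|exact: Ck_cst].
  move=> x Cx; rewrite /= /H /T flat_le0// subr_le0.
  rewrite powR12_sqrt ?(ltW (q0 _ (sqdist_ge0 _ _)))//.
  rewrite -[leLHS](ger0_norm (ltW C0)) -sqrtr_sqr ler_sqrt ?(ltW (q0 _ (sqdist_ge0 _ _)))//.
  by rewrite (le_trans (ltW Cx))// lerDl sqr_ge0.
- move=> x; have qx := q0 _ (sqdist_ge0 c x).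
  have -> : gradient (H \o sqdist c) x = (- (2 * dH (sqdist c x))) *: (x - c).
    apply: rV_ext => i; rewrite !mxE /partial.
    have [_ ->] := @is_derive_comp _ _ _ H x _ _ _ (is_derive_sqdist c i x) (Hd _ (sqdist_ge0 c x)).
    by ring.
  rewrite enormZ normrN ger0_norm; last by rewrite /dH !mulr_ge0 ?powR_ge0.
  rewrite (_ : 2 * _ * _ = dT (C - (q (sqdist c x)) `^ 2^-1) *
      ((q (sqdist c x)) `^ (2^-1 - 1) * enorm (x - c))); last first.
    by rewrite /dH; field.
  rewrite -[leRHS]mulr1; apply: ler_pM => //.
    by rewrite mulr_ge0 ?powR_ge0 ?enorm_ge0.
  rewrite (_ : 2^-1 - 1 = - 2^-1); last by field.
  rewrite powRN mulrC ler_pdivrMr ?powR_gt0// mul1r powR12_sqrt ?(ltW qx)//.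
  by rewrite /enorm ler_sqrt ?(ltW qx)// -enorm_sqr -sqdistE lerDl sqr_ge0.
- rewrite /= /H /q sqdist_center add0r powR12_sqrt ?sqr_ge0// sqrtr_sqr gtr0_norm//.
  apply: lt_le_trans (TE _ _); rewrite /C; lra.
Qed.

End radial_test_functions.

(** * The integrals of |phi|^p and |grad phi|^p *)

Section energies.
Context {R : realType} {n : nat}.
Variable Omega : set 'rV[R]_n.
Local Notation mu := (@lebesgue_rV R n).
Implicit Types (phi f : 'rV[R]_n -> R).

Local Notation supp phi := (closure [set x | phi x != 0]).

Lemma test_continuous phi : test_function Omega phi -> continuous phi.
Proof. by move=> [sphi _ _]; exact: Ck_continuous (sphi 0%N). Qed.

Lemma test_is_derive phi i x : test_function Omega phi ->
  is_derive x (delta_mx ord0 i) phi (partial i phi x).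
Proof. by move=> [sphi _ _]; exact: Ck_is_derive (sphi 1%N). Qed.

Lemma test_partial_continuous phi i : test_function Omega phi ->
  continuous (partial i phi).
Proof.
by move=> [sphi _ _]; have [_ /(_ i)[_ h]] := sphi 1%N; exact: (@Ck_continuous _ _ 0 _ h).
Qed.

Lemma test_out phi x : ~ supp phi x -> phi x = 0.
Proof.
move=> nx; apply/eqP/negPn/negP => px; apply: nx; exact: subset_closure.
Qed.

Lemma test_partial_out phi i x : ~ supp phi x -> partial i phi x = 0.
Proof.
move=> nx; have [_ <-] : is_derive x (delta_mx ord0 i) phi 0; last by [].
apply: (near_eq_is_derive _ (is_derive_cst 0 _ _)).
have : nbhs x (~` supp phi).
  apply: open_nbhs_nbhs; split => //.
  exact/closed_openC/closed_closure.
by apply: filterS => y /test_out ->.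
Qed.

Lemma test_cc phi f : test_function Omega phi -> continuous f ->
  (forall x, ~ supp phi x -> f x = 0) -> Cc f.
Proof.
move=> [_ cK _] cf f0; split => //.
have [M [_ hM]] := compact_bounded cK.
exists (`|M| + 2) => [|x nx]; first by rewrite ltr_wpDl.
apply: f0 => Kx; apply: nx; rewrite -ball_normE/= sub0r normrN.
apply: (@le_lt_trans _ _ (`|M| + 1)); last by rewrite ltrD2l ltr1n.
by apply: (hM (`|M| + 1)) => //; rewrite (le_lt_trans (ler_norm _))// ltrDl.
Qed.

(** Integrals over [Omega] of functions carried by the support of a test function
    are integrals over the whole space, where [integral_partial] applies. *)
Lemma integral_test phi (h : 'rV[R]_n -> \bar R) : test_function Omega phi ->
  (forall x, ~ supp phi x -> h x = 0%E) ->
  (\int[mu]_(x in Omega) h x = \int[mu]_x h x)%E.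
Proof.
move=> [_ _ KO] h0; rewrite integral_mkcond; apply: eq_integral => x _.
rewrite patchE; case: ifPn => // /negP nx; rewrite h0// => /KO Ox.
by apply: nx; rewrite inE.
Qed.

Lemma cc_integralE f : Cc f -> (\int[mu]_x (f x)%:E = (\int[mu]_x f x)%R%:E)%E.
Proof. by move=> ccf; rewrite fineK//; apply: integrable_fin_num => //; exact: cc_integrable. Qed.

Definition pmass (p : R) phi : R := (\int[mu]_x (`|phi x| `^ p))%R.
Definition penergy (p : R) phi : R := (\int[mu]_x (enorm (gradient phi x) `^ p))%R.

Lemma cc_pmass p phi : 0 < p -> test_function Omega phi ->
  Cc (fun x => `|phi x| `^ p).
Proof.
move=> p0 tphi; apply: (test_cc tphi).
  move=> x; apply: (@continuous_comp _ _ _ phi (fun t : R => `|t| `^ p)).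
    exact: test_continuous.
  exact: continuous_normr_powR.
by move=> x nx; rewrite test_out// normr_powR0.
Qed.

Lemma continuous_enorm_gradient phi : test_function Omega phi ->
  continuous (fun x => enorm (gradient phi x)).
Proof.
move=> tphi x; apply: continuous_enorm_comp => i; rewrite mxE.
under eq_fun do rewrite mxE.
exact: test_partial_continuous.
Qed.

Lemma enorm_gradient_out phi x : ~ supp phi x -> enorm (gradient phi x) = 0.
Proof.
move=> nx; rewrite (_ : gradient phi x = 0) ?enorm0//.
by apply: rV_ext => i; rewrite !mxE test_partial_out.
Qed.

Lemma cc_penergy p phi : 0 < p -> test_function Omega phi ->
  Cc (fun x => enorm (gradient phi x) `^ p).
Proof.
move=> p0 tphi.
have E : (fun x => enorm (gradient phi x) `^ p) = (fun x => `|enorm (gradient phi x)| `^ p).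
  by apply/funext => x; rewrite ger0_norm ?enorm_ge0.
rewrite E; apply: (test_cc tphi).
  move=> x; apply: (@continuous_comp _ _ _ (fun x => enorm (gradient phi x)) (fun t : R => `|t| `^ p)).
    exact: continuous_enorm_gradient.
  exact: continuous_normr_powR.
by move=> x nx; rewrite enorm_gradient_out// normr_powR0.
Qed.

Lemma pmass_ge0 p phi : 0 <= pmass p phi.
Proof. by apply: Rintegral_ge0 => x _; exact: powR_ge0. Qed.

Lemma penergy_ge0 p phi : 0 <= penergy p phi.
Proof. by apply: Rintegral_ge0 => x _; exact: powR_ge0. Qed.

Lemma intpow_pmass p phi : 0 < p -> test_function Omega phi ->
  intpow Omega p phi = (pmass p phi)%:E.
Proof.
move=> p0 tphi; rewrite /intpow (integral_test tphi) ?cc_integralE//.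
  exact: cc_pmass.
by move=> x nx; rewrite test_out// normr_powR0.
Qed.

Lemma intpow_penergy p phi : 0 < p -> test_function Omega phi ->
  intpow Omega p (fun x => enorm (gradient phi x)) = (penergy p phi)%:E.
Proof.
move=> p0 tphi; rewrite /intpow (integral_test tphi).
  under eq_integral => x _ do rewrite ger0_norm ?enorm_ge0//.
  by rewrite cc_integralE//; exact: cc_penergy.
by move=> x nx; rewrite enorm_gradient_out// normr_powR0.
Qed.

Lemma open_superlevel phi e : test_function Omega phi -> open [set x | e < `|phi x|].
Proof.
move=> tphi.
apply: (@open_comp _ _ (fun x => `|phi x|) [set y | e < y]); last exact: open_gt.
move=> x _; apply: continuous_comp; last exact: norm_continuous.
exact: test_continuous.
Qed.

(** Chebyshev's inequality. *)
Lemma pmass_ge_superlevel p phi e : 0 < p -> 0 < e -> test_function Omega phi ->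
  ((e `^ p)%:E * mu [set x | (e < `|phi x|)%R] <= (pmass p phi)%:E)%E.
Proof.
move=> p0 e0 tphi; set A := [set x | _].
have mA := open_rV_measurable (open_superlevel (e := e) tphi).
rewrite -cc_integralE; last exact: cc_pmass.
rewrite -integral_cst//.
have [cE _] := cc_pmass p0 tphi.
have mE : measurable_fun setT (fun x => (`|phi x| `^ p)%:E).
  by apply/measurable_EFinP; exact: continuous_rV_measurable.
apply: (@le_trans _ _ (\int[mu]_(x in A) (`|phi x| `^ p)%:E)%E).
  apply: ge0_le_integral => //.
  - by move=> x _; rewrite lee_fin powR_ge0.
  - exact: measurable_funTS.
  - by move=> x Ax; rewrite lee_fin ge0_ler_powR ?nnegrE ?(ltW e0) ?(ltW p0) ?(ltW Ax).
by apply: ge0_subset_integral => // x _; rewrite lee_fin powR_ge0.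
Qed.

Lemma pmass_gt0 p phi c : 0 < p -> test_function Omega phi -> phi c != 0 ->
  0 < pmass p phi.
Proof.
move=> p0 tphi pc; set e := `|phi c| / 2.
have e0 : 0 < e by rewrite divr_gt0// normr_gt0.
rewrite -lte_fin; apply: lt_le_trans (pmass_ge_superlevel p0 e0 tphi).
rewrite mule_gt0// ?lte_fin ?powR_gt0//.
apply: (@lebesgue_rV_open_gt0 _ _ _ c); first exact: open_superlevel.
by rewrite /= /e ltr_pdivrMr// mulr_natr mulr2n ltrDl normr_gt0.
Qed.

End energies.

(** * Density of the test functions *)

(** As [t] tends to 0 the coefficient [(1 - t) `^ (2 * (1 - p))] tends to 1.  The proof
    by contradiction takes the [t] for which the inverse of this coefficient is the
    midpoint between [A / X] and 1. *)
Lemma powR_limit_le (R : realType) (p X A : R) : 1 < p -> 0 <= A ->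
  (forall t, 0 < t < 1 -> X <= (1 - t) `^ (1 - p) * ((1 - t) `^ (1 - p) * A)) ->
  X <= A.
Proof.
move=> p1 A0 key.
rewrite leNgt; apply/negP => AB.
have X0 : 0 < X := le_lt_trans A0 AB.
pose q := 2 * (p - 1); have q0 : 0 < q by rewrite mulr_gt0// subr_gt0.
pose rho := A / X.
have rho1 : rho < 1 by rewrite /rho ltr_pdivrMr// mul1r.
have rho0 : 0 <= rho by rewrite divr_ge0// ltW.
pose s := ((rho + 1) / 2) `^ q^-1.
have s0 : 0 < s by rewrite powR_gt0//; lra.
have s1 : s < 1.
  rewrite -[ltRHS](_ : 1 `^ q^-1 = 1); last by rewrite powR1.
  by apply: gt0_ltr_powR; rewrite ?invr_gt0 ?nnegrE//; lra.
have := key (1 - s); rewrite subr_gt0 s1 ltrBlDr ltrDl s0 => /(_ isT).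
rewrite opprB addrCA subrr addr0 mulrA -powRD ?(gt_eqF s0) ?implybT//.
rewrite (_ : 1 - p + (1 - p) = - q); last by rewrite /q; ring.
rewrite powRN /s -powRrM mulVf ?gt_eqF// powRr1; last by lra.
rewrite [_^-1 * _]mulrC ler_pdivlMr; last by lra.
move=> h.
have E : A = rho * X by rewrite /rho divfK// gt_eqF.
have : rho * X < X * ((rho + 1) / 2) by rewrite mulrC ltr_pM2l//; lra.
by rewrite -E ltNge h.
Qed.

Section characterization.
Context {R : realType} {n : nat}.
Variable Omega : set 'rV[R]_n.
Hypothesis openO : open Omega.
Local Notation mu := (@lebesgue_rV R n).
Implicit Types (phi f u : 'rV[R]_n -> R) (g : 'rV[R]_n -> 'rV[R]_n).

Let mO : measurable Omega. Proof. exact: open_rV_measurable. Qed.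

Lemma intpow_ge0 p f : (0 <= intpow Omega p f)%E.
Proof. by apply: integral_ge0 => x _; rewrite lee_fin powR_ge0. Qed.

Lemma measurable_normr_powR p f : measurable_fun Omega f ->
  measurable_fun Omega (fun x => (`|f x| `^ p)%:E).
Proof.
move=> mf; apply/measurable_EFinP.
apply: (@measurableT_comp _ _ _ _ _ _ (fun y : R => y `^ p)) => //.
exact: measurableT_comp.
Qed.

Lemma intpowD p t (c a b : 'rV[R]_n -> R) : 1 <= p -> 0 < t < 1 ->
  measurable_fun Omega a -> measurable_fun Omega b -> measurable_fun Omega c ->
  (forall x, `|c x| <= `|a x| + `|b x|) ->
  (intpow Omega p c <= ((1 - t) `^ (1 - p))%:E * intpow Omega p a +
                       (t `^ (1 - p))%:E * intpow Omega p b)%E.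
Proof.
move=> p1 t01 ma mb mc cab.
have p0 : 0 <= p by rewrite (le_trans _ p1).
have ma' := measurable_normr_powR p ma; have mb' := measurable_normr_powR p mb.
have mc' := measurable_normr_powR p mc.
have pw0 f x : Omega x -> (0 <= (`|f x| `^ p)%:E)%E by rewrite lee_fin powR_ge0.
rewrite /intpow -(ge0_integralZl_EFin _ mO (pw0 a) ma' (powR_ge0 _ _)).
rewrite -(ge0_integralZl_EFin _ mO (pw0 b) mb' (powR_ge0 _ _)).
rewrite -ge0_integralD//; last first.
- by apply: emeasurable_funM => //; exact: measurable_cst.
- by move=> x _; rewrite mule_ge0// lee_fin powR_ge0.
- by apply: emeasurable_funM => //; exact: measurable_cst.
- by move=> x _; rewrite mule_ge0// lee_fin powR_ge0.
apply: ge0_le_integral => //.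
- by apply: emeasurable_funD; apply: emeasurable_funM => //; exact: measurable_cst.
move=> x _; rewrite -!EFinM -EFinD lee_fin.
apply: le_trans (powR_addl_le p1 t01 (normr_ge0 _) (normr_ge0 _)).
by rewrite ge0_ler_powR ?nnegrE ?addr_ge0.
Qed.

(** An inequality between the two integrals passes from the test functions to their
    closure W_0^{1,p}: apply [intpowD] to [grad phi_k = g - (g - grad phi_k)] and to
    [u = phi_k + (u - phi_k)], let [k] tend to infinity and then [t] to 0. *)
Lemma W01p_energy_le p M u g : 1 < p -> 0 <= M ->
  (forall phi, test_function Omega phi -> M * pmass p phi <= penergy p phi) ->
  W01p Omega p u g ->
  [/\ (intpow Omega p u < +oo)%E,
      (intpow Omega p (fun x => enorm (g x)) < +oo)%E &
      M * fine (intpow Omega p u) <= fine (intpow Omega p (fun x => enorm (g x)))].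
Proof.
move=> p1 M0 HM [[[mu_ uoo] Lg _] [phi [tphi uphi gphi]]].
have p0 : 0 < p by rewrite (lt_trans _ p1).
have mg : measurable_fun Omega (fun x => enorm (g x)).
  by apply: measurable_enorm => i; have [] := Lg i.
have mphi k : measurable_fun Omega (phi k).
  by apply: measurable_funTS; apply: continuous_rV_measurable; exact: test_continuous (tphi k).
have mgphi k : measurable_fun Omega (fun x => enorm (gradient (phi k) x)).
  apply: measurable_funTS; apply: continuous_rV_measurable.
  exact: continuous_enorm_gradient (tphi k).
have mu' k : measurable_fun Omega (fun x => u x - phi k x) by exact: measurable_funB.
have mg' k : measurable_fun Omega (fun x => enorm (g x - gradient (phi k) x)).
  apply: measurable_enorm => i; under eq_fun do rewrite !mxE.
  apply: measurable_funB; first by have [] := Lg i.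
  apply: measurable_funTS; apply: continuous_rV_measurable.
  exact: test_partial_continuous (tphi k).
have small e : 0 < e -> exists k, (intpow Omega p (fun x => u x - phi k x)%R < e%:E)%E /\
    (intpow Omega p (fun x => enorm (g x - gradient (phi k) x)) < e%:E)%E.
  move=> e0.
  have : \forall k \near \oo, (intpow Omega p (fun x => u x - phi k x)%R < e%:E)%E /\
    (intpow Omega p (fun x => enorm (g x - gradient (phi k) x)) < e%:E)%E.
    apply: filterI.
      by have := uphi [set y | (y < e%:E)%E]; apply; apply: open_ereal_lt'; rewrite lte_fin.
    by have := gphi [set y | (y < e%:E)%E]; apply; apply: open_ereal_lt'; rewrite lte_fin.
  by case=> k _ /(_ k (leqnn k)); exists k.
have tri1 k x : `|enorm (g x)| <= `|enorm (gradient (phi k) x)| + `|enorm (g x - gradient (phi k) x)|.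
  rewrite !ger0_norm ?enorm_ge0//; apply: le_trans (enormD _ _).
  by rewrite addrC subrK.
have tri2 k x : `|enorm (gradient (phi k) x)| <= `|enorm (g x)| + `|enorm (g x - gradient (phi k) x)|.
  rewrite !ger0_norm ?enorm_ge0// -[X in _ <= _ + X]enormN; apply: le_trans (enormD _ _).
  by rewrite opprB addrC subrK.
have tri3 k x : `|u x| <= `|phi k x| + `|u x - phi k x|.
  by apply: le_trans (ler_normD _ _); rewrite addrC subrK.
have goo : (intpow Omega p (fun x => enorm (g x)) < +oo)%E.
  have [k [_ k1]] := small 1 ltr01.
  have h2 : 0 < (2^-1 : R) < 1 by rewrite invr_gt0 invf_lt1 ?ltr1n ?ltr0n.
  apply: (le_lt_trans (intpowD (ltW p1) h2 (mgphi k) (mg' k) mg (tri1 k))).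
  have h0 : (0 <= (2^-1 `^ (1 - p) : R)%:E)%E by rewrite lee_fin powR_ge0.
  have hs : (0 <= ((1 - 2^-1) `^ (1 - p) : R)%:E)%E by rewrite lee_fin powR_ge0.
  apply: lte_add_pinfty; apply: lte_mul_pinfty.
  - exact: hs.
  - by [].
  - by rewrite (intpow_penergy p0 (tphi k)) ltry.
  - exact: h0.
  - by [].
  - exact: (lt_trans k1 (ltry _)).
split => //.
set A := intpow _ _ (fun x => enorm (g x)) in goo *; set B := intpow _ _ u in uoo *.
have Afin : A \is a fin_num by rewrite ge0_fin_numE ?intpow_ge0.
have Bfin : B \is a fin_num by rewrite ge0_fin_numE ?intpow_ge0.
have A0 : 0 <= fine A by rewrite fine_ge0 ?intpow_ge0.
have B0 : 0 <= fine B by rewrite fine_ge0 ?intpow_ge0.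
have key t : 0 < t < 1 -> M * fine B <= (1 - t) `^ (1 - p) * ((1 - t) `^ (1 - p) * fine A).
  move=> t01; apply/ler_addgt0Pr => e e0.
  pose s := (1 - t) `^ (1 - p); pose c := t `^ (1 - p).
  have s0 : 0 <= s := powR_ge0 _ _. have c0 : 0 <= c := powR_ge0 _ _.
  have cE0 : (0 <= c%:E)%E by rewrite lee_fin.
  pose K := s * c + M * c + 1.
  have K0 : 0 < K by rewrite ltr_wpDl// addr_ge0// mulr_ge0.
  have [k [k1 k2]] := small (e / K) (divr_gt0 e0 K0).
  have i1 := intpowD (ltW p1) t01 mg (mg' k) (mgphi k) (tri2 k).
  have i2 := intpowD (ltW p1) t01 (mphi k) (mu' k) mu_ (tri3 k).
  rewrite (intpow_penergy p0 (tphi k)) -/A -/s -/c -(fineK Afin) in i1.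
  rewrite (intpow_pmass p0 (tphi k)) -/B -/s -/c -(fineK Bfin) in i2.
  have h1 : penergy p (phi k) <= s * fine A + c * (e / K).
    rewrite -lee_fin; apply: (le_trans i1); rewrite EFinD EFinM [(c * _)%:E]EFinM.
    exact: (leeD2l _ (lee_wpmul2l cE0 (ltW k2))).
  have h2 : fine B <= s * pmass p (phi k) + c * (e / K).
    rewrite -lee_fin; apply: (le_trans i2); rewrite EFinD EFinM [(c * _)%:E]EFinM.
    exact: (leeD2l _ (lee_wpmul2l cE0 (ltW k1))).
  have h3 := HM _ (tphi k).
  have h4 : M * fine B <= s * (s * fine A + c * (e / K)) + M * (c * (e / K)).
    apply: (le_trans (ler_wpM2l M0 h2)); rewrite mulrDr lerD2r mulrCA.
    exact: (ler_wpM2l s0 (le_trans h3 h1)).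
  apply: (le_trans h4); rewrite mulrDr -addrA lerD2l.
  rewrite [leLHS](_ : _ = (s * c + M * c) * (e / K)); last by ring.
  rewrite mulrA ler_pdivrMr// mulrC ler_wpM2l ?(ltW e0)//.
  by rewrite /K lerDl.
exact: powR_limit_le p1 A0 key.
Qed.

End characterization.

(** * The eigenvalue as an infimum over test functions *)

Section eigenvalue.
Context {R : realType} {n : nat}.
Variable Omega : set 'rV[R]_n.
Hypothesis openO : open Omega.
Local Notation mu := (@lebesgue_rV R n).
Implicit Types (phi psi f u : 'rV[R]_n -> R) (g : 'rV[R]_n -> 'rV[R]_n).
Local Notation supp phi := (closure [set x | phi x != 0]).

Let mO : measurable Omega. Proof. exact: open_rV_measurable. Qed.

(** [integral_partial] applied to the product [phi * psi]. *)
Lemma test_integral_by_parts phi psi i :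
  test_function Omega phi -> test_function Omega psi ->
  (\int[mu]_(x in Omega) (phi x * partial i psi x) =
   - \int[mu]_(x in Omega) (partial i phi x * psi x))%R.
Proof.
move=> tphi tpsi.
have [cphi cpsi] := (test_continuous tphi, test_continuous tpsi).
have [dphi dpsi] := (test_partial_continuous (i := i) tphi, test_partial_continuous (i := i) tpsi).
have cc1 : Cc (fun x => phi x * partial i psi x).
  apply: (test_cc tphi) => [x|x nx]; last by rewrite test_out ?mul0r.
  exact: (cvgM (cphi x) (dpsi x)).
have cc2 : Cc (fun x => partial i phi x * psi x).
  apply: (test_cc tphi) => [x|x nx]; last by rewrite test_partial_out ?mul0r.
  exact: (cvgM (dphi x) (cpsi x)).
have cc3 : Cc (fun x => phi x * psi x).
  apply: (test_cc tphi) => [x|x nx]; last by rewrite test_out ?mul0r.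
  exact: (cvgM (cphi x) (cpsi x)).
have := integral_partial (i := i) (dG := fun x => phi x * partial i psi x + psi x * partial i phi x) cc3.
have d x : is_derive x (delta_mx ord0 i) (fun x => phi x * psi x)
    (phi x * partial i psi x + psi x * partial i phi x).
  exact: (is_deriveM (test_is_derive i x tphi) (test_is_derive i x tpsi)).
have cd : continuous (fun x => phi x * partial i psi x + psi x * partial i phi x).
  by move=> x; exact: (cvgD (cvgM (cphi x) (dpsi x)) (cvgM (cpsi x) (dphi x))).
move=> /(_ d cd) I0.
have E1 : (\int[mu]_(x in Omega) (phi x * partial i psi x) = \int[mu]_x (phi x * partial i psi x))%R.
  by rewrite /Rintegral (integral_test tphi)// => x nx; rewrite test_out ?mul0r.
have E2 : (\int[mu]_(x in Omega) (partial i phi x * psi x) = \int[mu]_x (partial i phi x * psi x))%R.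
  by rewrite /Rintegral (integral_test tphi)// => x nx; rewrite test_partial_out ?mul0r.
rewrite E1 E2; apply/eqP; rewrite -addr_eq0.
rewrite -RintegralD//; [|exact: cc_integrable|exact: cc_integrable].
rewrite /Rintegral; under eq_integral => x _ do rewrite [partial i phi x * _]mulrC.
by rewrite I0.
Qed.

Lemma test_W01p p phi : 0 < p -> test_function Omega phi ->
  W01p Omega p phi (gradient phi).
Proof.
move=> p0 tphi; split; last first.
  exists (fun=> phi); split => //.
    rewrite (_ : (fun _ => _) = (fun=> 0%E)); first exact: cvg_cst.
    apply/funext => k; apply: integral0_eq => x _.
    by rewrite subrr normr_powR0.
  rewrite (_ : (fun _ => _) = (fun=> 0%E)); first exact: cvg_cst.
  apply/funext => k; apply: integral0_eq => x _.
  by rewrite subrr enorm0 normr_powR0.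
split.
- split; last by rewrite intpow_pmass// ltry.
  by apply: measurable_funTS; apply: continuous_rV_measurable; exact: test_continuous tphi.
- move=> i; rewrite (_ : (fun _ => _) = partial i phi); last by apply/funext => x; rewrite mxE.
  have cd := test_partial_continuous (i := i) tphi; split.
    by apply: measurable_funTS; exact: continuous_rV_measurable.
  rewrite /intpow (integral_test tphi); last first.
    by move=> x nx; rewrite test_partial_out// normr_powR0.
  rewrite cc_integralE ?ltry//; apply: (test_cc tphi).
    move=> x; apply: (@continuous_comp _ _ _ (partial i phi) (fun t : R => `|t| `^ p)).
      exact: cd.
    exact: continuous_normr_powR.
  by move=> x nx; rewrite test_partial_out// normr_powR0.
- move=> psi i tpsi; rewrite test_integral_by_parts//; congr (- _).
  by apply: eq_Rintegral => x _; rewrite mxE.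
Qed.

Lemma test_not_ae0 p phi : 0 < p -> test_function Omega phi ->
  0 < pmass p phi -> ~ {ae mu, forall x, Omega x -> phi x = 0}.
Proof.
move=> p0 tphi E0 ae0; move: E0; rewrite -lte_fin -(intpow_pmass p0 tphi).
rewrite /intpow (ae_eq_integral (cst 0%E)) ?integral0 ?ltxx//.
  apply: measurable_normr_powR; apply: measurable_funTS.
  by apply: continuous_rV_measurable; exact: test_continuous tphi.
by apply: filterS ae0 => x h Ox; rewrite h// normr_powR0.
Qed.

Lemma not_ae0_intpow_gt0 p u : 0 < p -> measurable_fun Omega u ->
  ~ {ae mu, forall x, Omega x -> u x = 0} -> (0 < intpow Omega p u)%E.
Proof.
move=> p0 mu_ nae; rewrite lt0e intpow_ge0 andbT; apply/eqP => I0; apply: nae.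
have mp := measurable_normr_powR p mu_.
have : ae_eq mu Omega (fun x => (`|u x| `^ p)%:E) (cst 0%E).
  apply/(ae_eq_integral_abs mu mO mp); rewrite -[RHS]I0.
  by apply: eq_integral => x _; rewrite gee0_abs// lee_fin powR_ge0.
apply: filterS => x h Ox; have [] := h Ox.
by move=> /powR_eq0_eq0/normr0_eq0.
Qed.

Definition rayleigh_set p := [set q : R | exists u g,
    [/\ W01p Omega p u g, ~ {ae mu, forall x, Omega x -> u x = 0} &
        q = rayleigh Omega p u g]].

Lemma rayleigh_set_lb p : lbound (rayleigh_set p) 0.
Proof.
move=> q [u [g [_ _ ->]]]; rewrite divr_ge0// fine_ge0//; exact: intpow_ge0.
Qed.

(** A test function, with its gradient, is itself an admissible competitor. *)
Lemma lambda1_lt p y phi : 0 < p -> test_function Omega phi ->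
  penergy p phi < y * pmass p phi -> lambda1 p Omega < y.
Proof.
move=> p0 tphi H.
have E0 : 0 < pmass p phi.
  rewrite lt0r pmass_ge0 andbT; apply/eqP => E0; move: H.
  by rewrite E0 mulr0 ltNge penergy_ge0.
apply: (@le_lt_trans _ _ (penergy p phi / pmass p phi)); last first.
  by rewrite ltr_pdivrMr.
apply: ge_inf; first by exists 0; exact: rayleigh_set_lb.
exists phi, (gradient phi); split; first exact: test_W01p.
  exact: test_not_ae0 E0.
by rewrite /rayleigh (intpow_penergy p0 tphi) (intpow_pmass p0 tphi).
Qed.

(** A bound valid for the test functions is valid on W_0^{1,p} by
    [W01p_energy_le].  The function [phi] shows that the infimum is taken over a
    nonempty set. *)
Lemma lambda1_ge p M phi : 1 < p -> 0 <= M ->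
  test_function Omega phi -> 0 < pmass p phi ->
  (forall psi, test_function Omega psi -> M * pmass p psi <= penergy p psi) ->
  M <= lambda1 p Omega.
Proof.
move=> p1 M0 tphi E0 HM; have p0 : 0 < p by rewrite (lt_trans _ p1).
apply: lb_le_inf.
  exists (rayleigh Omega p phi (gradient phi)), phi, (gradient phi); split => //.
    exact: test_W01p.
  exact: test_not_ae0 E0.
move=> q [u [g [Wug nae ->]]].
have [uoo goo le] := W01p_energy_le openO p1 M0 HM Wug.
have [[[mu_ _] _ _] _] := Wug.
have I0 := not_ae0_intpow_gt0 p0 mu_ nae.
have fine0 : 0 < fine (intpow Omega p u) by rewrite fine_gt0// I0 uoo.
by rewrite /rayleigh; move: le; rewrite -ler_pdivlMr.
Qed.

Lemma lambda1_lt_test p y phi : 1 < p ->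
  test_function Omega phi -> 0 < pmass p phi -> lambda1 p Omega < y ->
  exists2 psi, test_function Omega psi & penergy p psi < y * pmass p psi.
Proof.
move=> p1 tphi E0 ly; apply/not_exists2P => H.
have y0 : 0 <= y.
  apply: le_trans (ltW ly); apply: (lambda1_ge p1 (lexx 0) tphi E0) => psi _.
  rewrite mul0r; exact: penergy_ge0.
suff : y <= lambda1 p Omega by rewrite leNgt ly.
apply: (lambda1_ge p1 y0 tphi E0) => psi tpsi.
by rewrite leNgt; apply/negP; have [|] := H psi.
Qed.

Lemma continuous_powR_exp (a p : R) : 0 <= a -> 0 < p -> {for p, continuous (powR a)}.
Proof.
rewrite le_eqVlt => /predU1P[<-|a0] p0.
  apply: cvg_near_cst; near=> q.
  have q0 : 0 < q by near: q; exact: lt_nbhsr.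
  by rewrite !powR0 ?gt_eqF.
rewrite (_ : powR a = (fun q => expR (q * ln a))); last first.
  by apply/funext => q; rewrite /powR gt_eqF.
apply: (@continuous_comp _ _ _ (fun q : R => q * ln a) expR); last exact: continuous_expR.
apply: cvgM; [exact: cvg_id|exact: cvg_cst].
Unshelve. all: by end_near. Qed.

(** Dominated convergence: for exponents between [p / 2] and [p + 1] the integrand is
    at most the sum of the integrands for these two exponents. *)
Lemma continuous_integral_powR f p : (forall x, 0 <= f x) ->
  (forall q, 0 < q -> Cc (fun x => f x `^ q)) -> 0 < p ->
  {for p, continuous (fun q => \int[mu]_x (f x `^ q))%R}.
Proof.
move=> f0 ccf p0.
pose I : set R := `]p / 2, p + 1[%classic.
have Ip : p \in I by rewrite inE /I/= in_itv/=; lra.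
have I0 q : I q -> 0 < q by rewrite /I/= in_itv/=; lra.
have cc1 := ccf (p / 2) (divr_gt0 p0 (ltr0n _ 2)).
have cc2 := ccf (p + 1) (addr_gt0 p0 ltr01).
apply: (@continuity_under_integral R _ _ mu (fun q x => f x `^ q) setT _ (p / 2) (p + 1) _ _ (fun x => f x `^ (p / 2) + f x `^ (p + 1))) => //.
- by move=> q /I0 q0; apply: cc_integrable; exact: ccf.
- apply: nearW => x _ q; rewrite inE => /I0 q0; exact: continuous_powR_exp.
- have := integrableD measurableT (cc_integrable cc1) (cc_integrable cc2).
  by apply: eq_integrable.
move=> q Iq; apply: nearW => x _; rewrite ger0_norm ?powR_ge0//.
move: Iq; rewrite /I/= in_itv/= => /andP[q1 q2].
have [x1|x1] := leP 1 (f x).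
  by rewrite ler_wpDl ?powR_ge0//; apply: ler_powR => //; exact: ltW.
have [fx0|fx0] := eqVneq (f x) 0.
  by rewrite fx0 powR0 ?addr_ge0 ?powR_ge0// gt_eqF//; lra.
by rewrite ler_wpDr ?powR_ge0//; apply: ger_powR; rewrite ?(ltW q1)// lt0r fx0 f0 ltW.
Qed.

Lemma continuous_pmass phi p : test_function Omega phi -> 0 < p ->
  {for p, continuous (fun q => pmass q phi)}.
Proof.
move=> tphi p0; apply: continuous_integral_powR => // q q0; exact: cc_pmass tphi.
Qed.

Lemma continuous_penergy phi p : test_function Omega phi -> 0 < p ->
  {for p, continuous (fun q => penergy q phi)}.
Proof.
move=> tphi p0; apply: continuous_integral_powR => // [x|q q0].
  exact: enorm_ge0.
exact: cc_penergy tphi.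
Qed.

Lemma energy_lt_near phi p y : test_function Omega phi -> 0 < p ->
  penergy p phi < y * pmass p phi ->
  \forall q \near p, penergy q phi < y * pmass q phi.
Proof.
move=> tphi p0 H.
have c : (y * pmass q phi - penergy q phi) @[q --> p] --> y * pmass p phi - penergy p phi.
  apply: cvgB; last exact: continuous_penergy.
  by apply: cvgM; [exact: cvg_cst|exact: continuous_pmass].
have : \forall q \near p, 0 < y * pmass q phi - penergy q phi.
  by apply: (cvgr_gt _ c); rewrite subr_gt0.
by apply: filterS => q; rewrite subr_gt0.
Qed.

(** Upper semicontinuity in the exponent: a test function whose quotient is less
    than [y] at [p] keeps this property near [p]. *)
Lemma lambda1_lt_near p y phi : 1 < p ->
  test_function Omega phi -> 0 < pmass p phi -> lambda1 p Omega < y ->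
  \forall q \near p, lambda1 q Omega < y.
Proof.
move=> p1 tphi E0 /(lambda1_lt_test p1 tphi E0)[psi tpsi H].
have p0 : 0 < p by rewrite (lt_trans _ p1).
apply: filterS2 (lt_nbhsr p0) (energy_lt_near tpsi p0 H) => q q0.
exact: lambda1_lt.
Qed.

End eigenvalue.

(** * Lower bounds by vector fields *)

Section divergence_theorem.
Context {R : realType} {n : nat}.
Variable Omega : set 'rV[R]_n.
Local Notation mu := (@lebesgue_rV R n).
Implicit Types (phi : 'rV[R]_n -> R).
Local Notation supp phi := (closure [set x | phi x != 0]).

Lemma ccZ (k : R) (f : 'rV[R]_n -> R) : Cc f -> Cc (fun x => k * f x).
Proof.
move=> [cf [M M0 fM]]; split; last by exists M => // x /fM ->; rewrite mulr0.
by move=> x; exact: (cvgM (@cvg_cst R k _ (nbhs x) _) (cf x)).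
Qed.

Lemma ccB (f g : 'rV[R]_n -> R) : Cc f -> Cc g -> Cc (fun x => f x - g x).
Proof.
move=> [cf [M M0 fM]] [cg [M' M0' gM]]; split.
  by move=> x; exact: (cvgB (cf x) (cg x)).
exists (Num.max M M') => [|x nx]; first by rewrite lt_max M0.
rewrite fM ?gM ?subrr// => h; apply: nx; apply: le_ball h; rewrite le_max lexx ?orbT//.
Qed.

Lemma near_not_supp phi x : ~ supp phi x -> \near x, ~ supp phi x.
Proof.
move=> nx; apply: open_nbhs_nbhs; split => //.
exact/closed_openC/closed_closure.
Qed.

Lemma continuous_off_supp phi (h : 'rV[R]_n -> R) : test_function Omega phi ->
  (forall x, ~ supp phi x -> h x = 0) ->
  (forall x, Omega x -> {for x, continuous h}) -> continuous h.
Proof.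
move=> [_ _ KO] h0 ch x; have [Ox|nOx] := pselect (Omega x); first exact: ch.
have nx : ~ supp phi x by move=> /KO.
rewrite /continuous_at (h0 _ nx).
apply: (@cvg_near_cst _ R 0 h (nbhs x) _); apply: filterS (near_not_supp nx) => y; exact: h0.
Qed.

(** The divergence theorem for a field carried by the support of a test function.
    Regularity is required on [Omega] only, because the fields used below blow up
    or are meaningless outside of it. *)
Theorem test_divergence phi (G dG : 'I_n -> 'rV[R]_n -> R) :
  test_function Omega phi ->
  (forall i x, ~ supp phi x -> G i x = 0 /\ dG i x = 0) ->
  (forall i x, Omega x -> [/\ {for x, continuous (G i)},
     {for x, continuous (dG i)} & is_derive x (delta_mx ord0 i) (G i) (dG i x)]) ->
  Cc (fun x => \sum_i dG i x) /\ (\int[mu]_x (\sum_i dG i x))%R = 0.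
Proof.
move=> tphi G0 HG.
have cG i : continuous (G i).
  apply: (continuous_off_supp tphi) => x; first by move=> /(G0 i)[].
  by move=> /(HG i)[].
have cdG i : continuous (dG i).
  apply: (continuous_off_supp tphi) => x; first by move=> /(G0 i)[].
  by move=> /(HG i)[].
have ccG i : Cc (G i) by apply: (test_cc tphi) => // x /(G0 i)[].
have ccdG i : Cc (dG i) by apply: (test_cc tphi) => // x /(G0 i)[].
have dGE i x : is_derive x (delta_mx ord0 i) (G i) (dG i x).
  have [Ox|nOx] := pselect (Omega x); first by have [] := HG i x Ox.
  have nx : ~ supp phi x by move: nOx; apply: contra_not; have [_ _] := tphi; apply.
  rewrite (G0 i x nx).2; apply: (near_eq_is_derive _ (is_derive_cst 0 _ _)).
  by have := near_not_supp nx; apply: filterS => y /(G0 i)[->].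
split.
  apply: (test_cc tphi) => [x|x nx].
    exact: (@cvg_sumr R _ _ (nbhs x) _ _ dG (dG^~ x) (fun i => cdG i x)).
  by apply: big1 => i _; have [] := G0 i x nx.
rewrite /Rintegral; under eq_integral do rewrite -sumEFin.
rewrite integral_sum//; last by move=> i; exact: cc_integrable.
by rewrite big1// => i _; exact: integral_partial (ccG i) (dGE i) (cdG i).
Qed.

(** This is Picone's inequality in integrated form.  The divergence of
    [`|phi| ^ p F] has integral 0 and equals
    [`|phi| ^ p div F + p sg(phi) `|phi| ^ (p - 1) grad phi . F].  By the inequalities of
    Cauchy-Schwarz and Young the second term is at least
    [- `|grad phi| ^ p - (p - 1) `|phi| ^ p |F| ^ (p / (p - 1))], and the hypothesis on
    [div F] absorbs the last part. *)
Theorem vector_field_bound p Lam (F dF : 'I_n -> 'rV[R]_n -> R) phi : 1 < p ->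
  (forall i x, Omega x -> [/\ {for x, continuous (F i)},
     {for x, continuous (dF i)} & is_derive x (delta_mx ord0 i) (F i) (dF i x)]) ->
  (forall x, Omega x ->
     Lam + (p - 1) * (enorm (\row_i F i x)) `^ (p / (p - 1)) <= \sum_i dF i x) ->
  test_function Omega phi -> Lam * pmass p phi <= penergy p phi.
Proof.
move=> p1 HF HL tphi; have p0 : 0 < p by rewrite (lt_trans _ p1).
have p10 : 0 < p - 1 by rewrite subr_gt0.
pose G i x := `|phi x| `^ p * F i x.
pose dG i x := `|phi x| `^ p * dF i x + F i x * (p * spow p (phi x) * partial i phi x).
have cphi := test_continuous tphi.
have cpw : continuous (fun x => `|phi x| `^ p).
  move=> x; apply: (@continuous_comp _ _ _ phi (fun t : R => `|t| `^ p)); first exact: cphi.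
  exact: continuous_normr_powR.
have [|i x Ox|ccd int0] := test_divergence (G := G) (dG := dG) tphi.
- move=> i x nx; rewrite /G /dG test_out// normr_powR0// !mul0r; split=> //.
  by rewrite test_partial_out// !mulr0 addr0.
- have [cF cdF dFE] := HF i x Ox; split.
  + exact: (cvgM (cpw x) cF).
  + apply: (cvgD (cvgM (cpw x) cdF)); apply: (cvgM cF).
    apply: cvgM; last exact: (test_partial_continuous tphi).
    apply: cvgM; first exact: cvg_cst.
    apply: (@continuous_comp _ _ _ phi (spow p)); first exact: cphi.
    exact: continuous_spow.
  + have d1 := is_derive_comp (test_is_derive i x tphi) (is_derive_normr_powR (phi x) p1).
    exact: (is_deriveM d1 dFE).
have cc0 := cc_pmass p0 tphi; have cc1 := cc_penergy p0 tphi.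
have pt x : Lam * `|phi x| `^ p - enorm (gradient phi x) `^ p <= \sum_i dG i x.
  have [Ox|nOx] := pselect (Omega x); last first.
    have nx : ~ supp phi x by move: nOx; apply: contra_not; have [_ _] := tphi; apply.
    rewrite enorm_gradient_out// test_out// normr_powR0// mulr0 powR0 ?gt_eqF// subr0.
    rewrite big1// => i _; rewrite /dG test_out// test_partial_out//.
    by rewrite normr_powR0// mul0r !mulr0 addr0.
  set X := `|phi x| `^ p; set V := \row_i F i x.
  have X0 : 0 <= X := powR_ge0 _ _.
  have -> : \sum_i dG i x = X * \sum_i dF i x +
      p * (spow p (phi x) * \sum_i gradient phi x ord0 i * V ord0 i).
    rewrite !mulr_sumr -big_split/=; apply: eq_bigr => i _; rewrite /dG !mxE -/X; ring.
  have cs : - (`|phi x| `^ (p - 1) * (enorm (gradient phi x) * enorm V)) <=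
      spow p (phi x) * \sum_i gradient phi x ord0 i * V ord0 i.
    rewrite -(normr_spow _ p1) lerNl -mulrN.
    apply: (le_trans (ler_norm _)); rewrite normrM normrN ler_wpM2l//.
    rewrite ler_norml cauchy_schwarz andbT lerNl -sumrN -[enorm (gradient _ _)]enormN.
    under eq_bigr do rewrite -mulNr.
    have := cauchy_schwarz (- gradient phi x) V.
    rewrite (eq_bigr (fun i => - gradient phi x ord0 i * V ord0 i))// => i _.
    by rewrite !mxE.
  have yg := young_powR p1 (enorm_ge0 (gradient phi x))
    (mulr_ge0 (powR_ge0 `|phi x| (p - 1)) (enorm_ge0 V)).
  have HLx := ler_wpM2l X0 (HL x Ox); rewrite -/V in HLx.
  have XE : (`|phi x| `^ (p - 1) * enorm V) `^ (p / (p - 1)) = X * enorm V `^ (p / (p - 1)).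
    rewrite powRM ?powR_ge0 ?enorm_ge0// -powRrM mulrCA divff ?gt_eqF// mulr1//.
  rewrite XE in yg.
  have := ler_wpM2l (ltW p0) cs.
  move: HLx yg; set S := \sum_i dF i x; set S' := _ * \sum_i _.
  set a := enorm (gradient phi x); set b := enorm V; set c := _ `^ (p - 1); set e := b `^ _.
  rewrite [c * (a * b)]mulrCA.
  set Y := a * (c * b); set ap := a `^ p => h1 h2 h3.
  have -> : Lam * X - ap = X * (Lam + (p - 1) * e) - (ap + (p - 1) * (X * e)) by ring.
  apply: lerD => //; apply: le_trans h3; by rewrite mulrN lerN2.
rewrite -subr_le0 -[leRHS]int0.
have -> : Lam * pmass p phi - penergy p phi =
   (\int[mu]_x (Lam * `|phi x| `^ p - enorm (gradient phi x) `^ p))%R.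
  rewrite RintegralB//; [|exact/cc_integrable/ccZ|exact: cc_integrable].
  by rewrite RintegralZl//; exact: cc_integrable.
by apply: le_Rintegral => //; [exact/cc_integrable/ccB/cc1/ccZ|exact: cc_integrable].
Qed.

(** Integrate the divergence of [phi(x) (x - c)], which is
    [n phi(x) - g(x) |x - c| ^ 2], and note that [|grad phi| = g |x - c|] vanishes where
    [|x - c| < a]. *)
Lemma step_energy phi (g : 'rV[R]_n -> R) (c : 'rV[R]_n) (a : R) :
  0 < a -> test_function Omega phi ->
  (forall x, 0 <= phi x) ->
  (forall i x, partial i phi x = - g x * (x ord0 i - c ord0 i)) ->
  (forall x, 0 <= g x /\ (sqdist c x < a ^+ 2 -> g x = 0)) ->
  a * penergy 1 phi <= n%:R * pmass 1 phi.
Proof.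
move=> a0 tphi phi0 dphi Hg.
pose G (i : 'I_n) x := phi x * (x ord0 i - c ord0 i).
pose dG (i : 'I_n) x := phi x + (x ord0 i - c ord0 i) * partial i phi x.
have cphi := test_continuous tphi.
have cx (i : 'I_n) (x : 'rV[R]_n) : {for x, continuous (fun x : 'rV[R]_n => x ord0 i - c ord0 i)}.
  exact: (cvgB (@coord_continuous R 1 n ord0 i x) (@cvg_cst R (c ord0 i) _ (nbhs x) _)).
have [|i x Ox|ccd int0] := test_divergence (G := G) (dG := dG) tphi.
- move=> i x nx; rewrite /G /dG test_out// mul0r; split=> //.
  by rewrite test_partial_out// mulr0 addr0.
- split.
  + exact: (cvgM (cphi x) (cx i x)).
  + apply: (cvgD (cphi x)); apply: (cvgM (cx i x)).
    exact: (test_partial_continuous tphi).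
  + have d1 := is_deriveB (is_derive_coord i i x) (is_derive_cst (c ord0 i) x (delta_mx ord0 i)).
    apply: (is_derive_eq (is_deriveM (test_is_derive i x tphi) d1)).
    by rewrite eqxx subr0 [_ *: 1]mulr1.
have cc0 := cc_pmass ltr01 tphi; have cc1 := cc_penergy ltr01 tphi.
have i0 := cc_integrable cc0; have i1 := cc_integrable cc1; have id := cc_integrable ccd.
have pt x : a * enorm (gradient phi x) `^ 1 <= n%:R * `|phi x| `^ 1 - \sum_i dG i x.
  have [g0 g1] := Hg x.
  rewrite !powRr1 ?enorm_ge0// ger0_norm//.
  have -> : gradient phi x = (- g x) *: (x - c) by apply: rV_ext => i; rewrite !mxE dphi.
  have -> : \sum_i dG i x = n%:R * phi x - g x * sqdist c x.
    rewrite /dG big_split/= sumr_const card_ord mulr_natl; congr (_ + _).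
    rewrite /sqdist mulr_sumr -sumrN; apply: eq_bigr => i _; rewrite dphi; ring.
  rewrite opprB addrCA subrr addr0 enormZ normrN ger0_norm// mulrCA.
  have [xa|xa] := ltP (sqdist c x) (a ^+ 2); first by rewrite g1// !mul0r.
  rewrite ler_wpM2l// sqdistE expr2 ler_wpM2r ?enorm_ge0//.
  by rewrite leNgt -sqdist_lt ?(ltW a0)// -leNgt.
have -> : a * penergy 1 phi = (\int[mu]_x (a * enorm (gradient phi x) `^ 1))%R.
  by rewrite RintegralZl.
have -> : n%:R * pmass 1 phi = (\int[mu]_x (n%:R * `|phi x| `^ 1 - \sum_i dG i x))%R.
  rewrite RintegralB//; last exact/cc_integrable/ccZ.
  by rewrite int0 subr0 RintegralZl.
by apply: le_Rintegral => //; [exact/cc_integrable/ccZ|exact/cc_integrable/ccB/ccd/ccZ].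
Qed.

End divergence_theorem.

(** * The lower bound in a ball *)

Section ball_bound.
Context {R : realType} {n : nat}.
Variable Omega : set 'rV[R]_n.

(** The field is [F(x) = G(W(x)) (x - c)], where [W(x) = |x - c| ^ 2 + eps] and
    [G(w) = (p' / (R1 ^ p' - w ^ (p' / 2))) ^ (p - 1)] with [p' = p / (p - 1)].  For [eps = 0]
    it is [- |grad v| ^ (p - 2) grad v / v ^ (p - 1)] for the solution [v] of
    [- Delta_p v = 1] in the ball of radius [R1].  A positive [eps] keeps [W] away from 0,
    so that its powers are smooth, and the choice
    [eps = R1 ^ 2 - Rad ^ 2] keeps [W] below [R1 ^ 2] on [Omega].  The regularization acts
    in the right direction because [p <= 2], that is [p' / 2 >= 1]. *)
Lemma ball_energy_bound (c : 'rV[R]_n) (Rad R1 p : R) phi :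
  0 <= Rad < R1 -> 1 < p <= 2 -> Omega `<=` eball c Rad ->
  test_function Omega phi ->
  n%:R * ((p / (p - 1)) `^ (p - 1) * R1 `^ (- p)) * pmass p phi <= penergy p phi.
Proof.
move=> /andP[Rad0 RR1] /andP[p1 p2] OB tphi.
have p10 : 0 < p - 1 by rewrite subr_gt0.
have p0 : 0 < p by rewrite (lt_trans _ p1).
set p' := p / (p - 1).
have p'0 : 0 < p' by rewrite divr_gt0.
pose q := p' / 2.
have q1 : 1 <= q by rewrite /q /p' ler_pdivlMr// ler_pdivlMr//; lra.
have q0 : 0 < q by rewrite (lt_le_trans _ q1).
have R10 : 0 < R1 by rewrite (le_lt_trans Rad0).
pose eps := R1 ^+ 2 - Rad ^+ 2.
have eps0 : 0 < eps by rewrite subr_gt0 ltr_pXn2r// nnegrE ltW.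
pose D w := R1 `^ p' - w `^ q.
pose K := p' `^ (p - 1).
have K0 : 0 < K by rewrite powR_gt0.
pose G w := K * D w `^ (- (p - 1)).
pose dG w := (p - 1) * K * q * (w `^ (q - 1) * D w `^ (- p)).
have D0 w : 0 < w < R1 ^+ 2 -> 0 < D w.
  move=> /andP[w0 w1]; rewrite subr_gt0.
  have -> : R1 `^ p' = (R1 ^+ 2) `^ q.
    rewrite -powR_mulrn ?(ltW R10)// -powRrM; congr (_ `^ _).
    by rewrite /q mulrC divfK.
  by apply: gt0_ltr_powR; rewrite ?nnegrE ?(ltW w0) ?sqr_ge0.
have Dd w : 0 < w < R1 ^+ 2 -> is_derive w (1 : R) D (- (q * w `^ (q - 1))).
  move=> /andP[w0 _].
  apply: (is_derive_eq (is_deriveB (is_derive_cst (R1 `^ p') w 1) (is_derive1_powR q w0))).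
  by rewrite sub0r.
have Gd w : 0 < w < R1 ^+ 2 -> is_derive w (1 : R) G (dG w).
  move=> w01.
  have d1 := @is_derive1_comp R (@powR R ^~ (- (p - 1))) D w _ _ (is_derive1_powR _ (D0 _ w01)) (Dd _ w01).
  apply: (is_derive_eq (is_deriveZ K d1)).
  rewrite /dG (_ : - (p - 1) - 1 = - p); last by ring.
  rewrite /GRing.scale/=; ring.
have dcont f (w d : R) : is_derive w (1 : R) f d -> {for w, continuous f}.
  by move=> [fw _]; apply/differentiable_continuous/derivable1_diffP.
have dGc w : 0 < w < R1 ^+ 2 -> {for w, continuous dG}.
  move=> w01; have /andP[w0 _] := w01.
  apply: cvgM; first exact: cvg_cst.
  apply: cvgM; first exact: continuous_powR.
  apply: (@continuous_comp _ _ _ D (@powR R ^~ (- p))); first exact: dcont (Dd _ w01).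
  by apply: continuous_powR; exact: D0.
pose W x := sqdist c x + eps.
have W0 x : Omega x -> 0 < W x < R1 ^+ 2.
  move=> /OB; rewrite /eball/= -sqdist_lt// => h.
  by rewrite ltr_wpDl ?sqdist_ge0//= /W /eps addrCA gtrDl subr_lt0.
have cW x : {for x, continuous W}.
  rewrite /prop_for /continuous_at /W.
  exact: (cvgD (@continuous_sqdist R n c x) (@cvg_cst R eps _ (nbhs x) _)).
have Wd i x : is_derive x (delta_mx ord0 i) W (2 * (x ord0 i - c ord0 i)).
  apply: (is_derive_eq (is_deriveD (is_derive_sqdist c i x) (is_derive_cst eps x _))).
  by rewrite addr0.
pose F (i : 'I_n) (x : 'rV[R]_n) := (x ord0 i - c ord0 i) * G (W x).
pose dF (i : 'I_n) (x : 'rV[R]_n) :=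
  (x ord0 i - c ord0 i) * (dG (W x) * (2 * (x ord0 i - c ord0 i))) + G (W x).
refine (@vector_field_bound R n Omega p (n%:R * (K * R1 `^ (- p))) F dF phi p1 _ _ tphi).
  move=> i x Ox; have w01 := W0 x Ox.
  have cx : {for x, continuous (fun x : 'rV[R]_n => x ord0 i - c ord0 i)}.
    exact: (cvgB (@coord_continuous R 1 n ord0 i x) (@cvg_cst R (c ord0 i) _ (nbhs x) _)).
  have cG : {for x, continuous (G \o W)}.
    apply: (@continuous_comp _ _ _ W G); first exact: cW.
    exact: dcont (Gd _ w01).
  split.
  - exact: (cvgM cx cG).
  - have cdG : {for x, continuous (dG \o W)}.
      by apply: (@continuous_comp _ _ _ W dG); [exact: cW|exact: dGc].
    exact: (cvgD (cvgM cx (cvgM cdG (cvgM (@cvg_cst R 2 _ (nbhs x) _) cx))) cG).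
  - have d1 := is_deriveB (is_derive_coord i i x) (is_derive_cst (c ord0 i) x (delta_mx ord0 i)).
    have d2 := is_derive_comp (Wd i x) (Gd _ w01).
    apply: (is_derive_eq (is_deriveM d1 d2)).
    by rewrite eqxx subr0 [_ *: 1]mulr1.
move=> x Ox; have w01 := W0 x Ox; have /andP[w0 w1] := w01.
have Dw0 := D0 _ w01.
set w := W x in w01 w0 w1 Dw0 *.
set S := sqdist c x.
have S0 : 0 <= S := sqdist_ge0 _ _.
have Sw : S <= w by rewrite /w /W lerDl ltW.
have -> : \sum_i dF i x = n%:R * G w + 2 * dG w * S.
  rewrite /dF -/w big_split/= sumr_const card_ord addrC mulr_natl; congr (_ + _).
  by rewrite /S /sqdist mulr_sumr; apply: eq_bigr => i _; ring.
have Gw0 : 0 <= G w by rewrite mulr_ge0 ?powR_ge0// ltW.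
have -> : \row_i F i x = G w *: (x - c).
  by apply: rV_ext => i; rewrite !mxE /F -/w mulrC.
rewrite enormZ ger0_norm// powRM ?enorm_ge0//.
have -> : enorm (x - c) `^ p' = S * S `^ (q - 1).
  rewrite mulr_powRB1// /S sqdistE -powR_mulrn ?enorm_ge0// -powRrM.
  by congr (_ `^ _); rewrite /q mulrC divfK.
have -> : G w `^ p' = K * p' * D w `^ (- p).
  rewrite /G powRM ?(ltW K0) ?powR_ge0// -!powRrM; congr (_ * _ `^ _).
    rewrite (_ : (p - 1) * p' = p - 1 + 1); last by rewrite /p'; field; rewrite gt_eqF.
    by rewrite powRD ?powRr1 ?(ltW p'0)// (gt_eqF p'0) implybT.
  by rewrite /p'; field; rewrite gt_eqF.
apply: lerD.
  rewrite ler_wpM2l ?ler0n// /G -/K ler_wpM2l ?(ltW K0)//.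
  have -> : R1 `^ (- p) = (R1 `^ p') `^ (- (p - 1)).
    by rewrite -powRrM; congr (_ `^ _); rewrite /p'; field; rewrite gt_eqF.
  rewrite !powRN lef_pV2 ?posrE ?powR_gt0//.
  apply: ge0_ler_powR; rewrite ?nnegrE ?powR_ge0 ?(ltW p10) ?(ltW Dw0)//.
  by rewrite /D lerBlDr lerDl powR_ge0.
have -> : 2 * dG w * S = (p - 1) * (K * p' * D w `^ (- p) * (S * w `^ (q - 1))).
  by rewrite /dG /q; field.
have c0 : 0 <= K * p' * D w `^ (- p).
  exact: (mulr_ge0 (mulr_ge0 (ltW K0) (ltW p'0)) (powR_ge0 _ _)).
rewrite ler_wpM2l ?(ltW p10)// ler_wpM2l//.
rewrite ler_wpM2l//; apply: ge0_ler_powR; rewrite ?nnegrE ?subr_ge0//.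
exact: ltW.
Qed.

End ball_bound.

(** In logarithmic form the claim reads [- ln r < (p - 1) ln (p / (p - 1)) - p s], and
    [ln r] exceeds both 0 and [1 + ln s].  If [s <= 1/2], then [p = 1 / (1 - s)] makes the
    right-hand side [s / (1 - s) (- 1 - ln s)], which is nonnegative or at least
    [- 1 - ln s].  If [s > 1/2], then [p = 1 / s] makes it
    [- (1 / s - 1) ln (1 - s) - 1], which is at least [- ln s - 1] by concavity of [ln]. *)
Lemma exponent_choice (R : realType) (r s : R) : 1 < r -> 0 < s < 1 -> expR 1 * s < r ->
  exists2 p : R, 1 < p <= 2 & r^-1 < (p / (p - 1)) `^ (p - 1) * (expR s) `^ (- p).
Proof.
move=> r1 /andP[s0 s1] esr.
have r0 : 0 < r by rewrite (lt_trans _ r1).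
have lnr0 : 0 < ln r by rewrite ln_gt0.
have lnrs : 1 + ln s < ln r.
  have := esr; rewrite -ltr_ln ?posrE ?mulr_gt0 ?expR_gt0//.
  by rewrite lnM ?posrE ?expR_gt0// expRK.
have ss : 0 < 1 - s by rewrite subr_gt0.
have red p' p : 0 < p' -> - ln r < (p - 1) * ln p' - p * s ->
    r^-1 < p' `^ (p - 1) * (expR s) `^ (- p).
  move=> p'0 h; rewrite -ltr_ln ?posrE ?invr_gt0 ?mulr_gt0 ?powR_gt0 ?expR_gt0//.
  by rewrite lnV ?posrE// lnM ?posrE ?powR_gt0 ?expR_gt0// !ln_powR expRK mulNr.
have [s2|s2] := leP s (1 / 2).
  exists (1 - s)^-1.
    by rewrite invf_gt1// invf_ple ?posrE//; lra.
  rewrite (_ : (1 - s)^-1 / ((1 - s)^-1 - 1) = s^-1); last by field; lra.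
  apply: red; first by rewrite invr_gt0.
  rewrite lnV ?posrE//.
  rewrite (_ : _ - _ = s / (1 - s) * (- 1 - ln s)); last by field; lra.
  have k0 : 0 < s / (1 - s) by rewrite divr_gt0.
  have k1 : s / (1 - s) <= 1 by rewrite ler_pdivrMr//; lra.
  have [y|y] := leP 0 (- 1 - ln s).
    by rewrite (@lt_le_trans _ _ 0)// ?oppr_lt0// mulr_ge0// ltW.
  apply: (@lt_le_trans _ _ (- 1 - ln s)); first by lra.
  by rewrite -[leLHS]mul1r ler_wnM2r// ltW.
exists s^-1.
  by rewrite invf_gt1// s1/= invf_ple ?posrE//; lra.
rewrite (_ : s^-1 / (s^-1 - 1) = (1 - s)^-1); last by field; lra.
apply: red; first by rewrite invr_gt0.
rewrite lnV ?posrE// mulVf ?gt_eqF//.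
(* concavity of [ln] between 1 - s and 1, with weight a = 1 / s - 1 *)
pose a := s^-1 - 1.
have a0 : 0 < a by rewrite subr_gt0 invf_gt1.
have a1 : a < 1.
  have : s^-1 < 2 by rewrite invf_plt ?posrE//; lra.
  by rewrite /a; lra.
have bern : a * ln (1 - s) <= ln s.
  have := @concave_ln R (Itv01 (ltW a0) (ltW a1)) (1 - s) 1 ss ltr01.
  rewrite !convRE/= ln1 mulr0 addr0 => /le_trans; apply.
  rewrite (_ : _ + _ = s)//.
  by rewrite (_ : unstable.onem a = 1 - a)// /a; field; rewrite gt_eqF.
rewrite mulrN; rewrite -/a; lra.
Qed.

(** * The maximum *)

Section maximum.
Context {R : realType}.

Lemma seq_max (f : R -> R) (s : seq R) (x : R) : x \in s ->
  exists2 i, i \in s & forall j, j \in s -> f j <= f i.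
Proof.
elim: s x => // a [|b s] IH x _.
  by exists a => [|j]; rewrite inE// => /eqP ->.
have [i si hi] := IH b (mem_head _ _).
have [ai|ia] := leP (f a) (f i).
  exists i => [|j]; rewrite inE ?si ?orbT// => /predU1P[->//|]; exact: hi.
exists a => [|j]; rewrite inE ?eqxx// => /predU1P[->//|/hi ji].
by rewrite (le_trans ji)// ltW.
Qed.

(** If no point were a maximum, the interiors of the sets on which [f] is less than
    [f q] would form an open cover; the point with the largest value [f q] in a finite
    subcover would not be covered. *)
Lemma usc_attains_max (f : R -> R) (a b : R) : a <= b ->
  (forall p y, a <= p <= b -> f p < y -> \forall q \near p, f q < y) ->
  exists2 m, a <= m <= b & forall p, a <= p <= b -> f p <= f m.
Proof.
move=> ab usc; apply/not_exists2P => H.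
have big p : a <= p <= b -> exists2 q, a <= q <= b & f p < f q.
  move=> pab; apply/not_exists2P => K; have [|] := H p; first by [].
  by apply => q qab; rewrite leNgt; apply/negP; have [|] := K q.
have := @segment_compact R a b; rewrite compact_cover => cc.
have [||D DI cov] := cc R [set` `[a, b]] (fun q => [set p | f p < f q]°).
- by move=> q _; exact: open_interior.
- move=> p /=; rewrite in_itv/= => pab; have [q qab pq] := big p pab.
  by exists q; [rewrite /= in_itv|exact: usc].
have [d dD] : exists d, d \in finmap.enum_fset D.
  have [|d dD _] := cov a; first by rewrite /= in_itv/= lexx.
  by exists d.
have [i iD hi] := seq_max f dD.
have [|j jD] := cov i; first exact/set_mem/DI.
by move=> /interior_subset/=; rewrite ltNge hi.
Qed.
End maximum.

Section main.
Context {R : realType} {n : nat}.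
Local Notation mu := (@lebesgue_rV R n).

Lemma open_eball (c : 'rV[R]_n) (r : R) : open (eball c r).
Proof.
have [r0|r0] := leP 0 r; last first.
  rewrite (_ : eball c r = set0); first exact: open0.
  by apply/seteqP; split => // x; rewrite /eball/= ltNge (le_trans (ltW r0) (enorm_ge0 _)).
rewrite (_ : eball c r = sqdist c @^-1` [set y | y < r ^+ 2]).
  by apply: open_comp; [move=> x _; exact: continuous_sqdist|exact: open_lt].
by apply/funext => x; rewrite /eball/= -sqdist_lt.
Qed.

Variable Omega : set 'rV[R]_n.
Hypothesis openO : open Omega.

(** On the set where [|phi| > th], with [1 < th < phi c], the integrand of [pmass]
    is at least [th ^ p], which exceeds [p ln th]; and [|grad phi| ^ p <= |grad phi|]. *)
Lemma slope_energy_lt phi c (y : R) : test_function Omega phi ->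
  (forall x, enorm (gradient phi x) <= 1) -> 1 < phi c -> 0 < y ->
  exists2 P, 1 <= P & forall p, P <= p -> penergy p phi < y * pmass p phi.
Proof.
move=> tphi g1 pc y0.
pose th := (1 + phi c) / 2.
have th1 : 1 < th by rewrite /th; lra.
have thc : th < `|phi c| by rewrite (gtr0_norm (lt_trans ltr01 pc)) /th; lra.
have lnth : 0 < ln th by rewrite ln_gt0.
have th0 : 0 < th by rewrite (lt_trans _ th1).
pose A := [set x | th < `|phi x|].
have low p : 0 < p -> ((th `^ p)%:E * mu A <= (pmass p phi)%:E)%E.
  move=> p0; exact: (pmass_ge_superlevel p0 th0 tphi).
have A0 : (0 < mu A)%E.
  by apply: (@lebesgue_rV_open_gt0 _ _ _ c) => //; exact: open_superlevel tphi.
(* the lower bound at exponent 1 makes the measure of the superlevel set finite *)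
have Afin : mu A \is a fin_num.
  rewrite ge0_fin_numE ?measure_ge0// ltey; apply/eqP => Aoo.
  by have := low 1 ltr01; rewrite Aoo gt0_muley ?lte_fin ?powR_gt0.
set m := fine (mu A).
have m0 : 0 < m by rewrite fine_gt0// A0 ltey_eq Afin.
pose C := penergy 1 phi.
exists (Num.max 1 (C / (y * m * ln th))) => [|p]; first by rewrite le_max lexx.
rewrite ge_max => /andP[p1 pC].
have p0 : 0 < p by rewrite (lt_le_trans ltr01).
apply: (@le_lt_trans _ _ C).
  apply: le_Rintegral => //.
  - by apply: cc_integrable; exact: (cc_penergy p0 tphi).
  - by apply: cc_integrable; exact: (cc_penergy ltr01 tphi).
  move=> x _; have [->|g0] := eqVneq (enorm (gradient phi x)) 0.
    by rewrite !powR0 ?gt_eqF.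
  by apply: ger_powR => //; rewrite g1 lt0r g0 enorm_ge0.
apply: (@lt_le_trans _ _ (y * (th `^ p * m))); last first.
  rewrite ler_wpM2l ?(ltW y0)// -lee_fin EFinM /m fineK//; exact: low.
apply: (@le_lt_trans _ _ (y * (p * ln th * m))).
  rewrite ler_pdivrMr in pC; last by rewrite !mulr_gt0.
  by rewrite (le_trans pC)// le_eqVlt; apply/orP; left; apply/eqP; ring.
rewrite ltr_pM2l// ltr_pM2r// /powR gt_eqF//.
by rewrite (lt_le_trans _ (expR_ge1Dx _))// ltrDr.
Qed.

(** The bounds for exponents near 1, at [p0] and for large exponents are combined
    here.  The radius [R1 = expR s] of the auxiliary ball lies strictly above [Rad], and
    close enough to it that [expR 1 * s < r]. *)
Lemma lambda1_max_nonmonotone (r Rad : R) (c c' : 'rV[R]_n) :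
  (0 < n)%N -> 1 < r -> 1 < Rad < expR 1 -> expR 1 * ln Rad < r ->
  eball c r `<=` Omega -> Omega `<=` eball c' Rad ->
  (exists pstar : R, 1 < pstar /\
     forall p, 1 < p -> lambda1 p Omega <= lambda1 pstar Omega) /\
  non_monotone `]1, +oo[ (fun p => lambda1 p Omega).
Proof.
move=> n0 r1 /andP[Rad1 Rade] eRr cO Oc.
have r0 : 0 < r by rewrite (lt_trans _ r1).
have Rad0 : 0 < Rad by rewrite (lt_trans _ Rad1).
have e0 : 0 < expR (1 : R) := expR_gt0 1.
have lnR0 : 0 < ln Rad by rewrite ln_gt0.
have lnR1 : ln Rad < 1 by rewrite -[ltRHS]expRK ltr_ln ?posrE.
pose t := Num.min 1 (r / expR 1).
have lnRt : ln Rad < t by rewrite lt_min lnR1 ltr_pdivlMr// mulrC.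
pose s := (ln Rad + t) / 2.
have s1 : ln Rad < s by rewrite /s; lra.
have st : s < t by rewrite /s; lra.
have [s01 esr] : 0 < s < 1 /\ expR 1 * s < r.
  move: st; rewrite lt_min => /andP[-> h]; rewrite (lt_trans lnR0 s1); split => //.
  by rewrite mulrC -ltr_pdivlMr.
have RadR1 : 0 <= Rad < expR s by rewrite (ltW Rad0)/= -[ltLHS]lnK ?posrE// ltr_expR.
have [p0 p012 p0r] := exponent_choice r1 s01 esr.
have /andP[p01 _] := p012.
have n0R : (0 : R) < n%:R by rewrite ltr0n.
set kap := _ * _ in p0r.
pose Y := n%:R * kap.
have kap0 : 0 < kap by rewrite (lt_trans _ p0r)// invr_gt0.
have Y0 : 0 < Y by rewrite mulr_gt0.
have [phi [tphi g1 phic]] := slope_test_function r1 cO.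
have E0 p : 0 < p -> 0 < pmass p phi.
  by move=> pp; apply: (pmass_gt0 pp tphi (c := c)); rewrite gt_eqF// (lt_trans _ phic).
have YL : Y <= lambda1 p0 Omega.
  apply: (lambda1_ge openO p01 (ltW Y0) tphi).
    by apply: E0; rewrite (lt_trans _ p01).
  by move=> psi tpsi; exact: (ball_energy_bound RadR1 p012 Oc tpsi).
have [P P1 HP] := slope_energy_lt tphi g1 phic Y0.
have large p : 1 < p -> P <= p -> lambda1 p Omega < Y.
  move=> p1 Pp; apply: (lambda1_lt openO _ tphi); first by rewrite (lt_trans _ p1).
  exact: HP.
have nYr : n%:R / Y < r.
  by rewrite /Y invfM mulrA divff ?gt_eqF// mul1r invf_plt.
pose a := (n%:R / Y + r) / 2.
have nYa : n%:R / Y < a by rewrite /a; lra.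
have ar : a < r by rewrite /a; lra.
have a0 : 0 < a by rewrite (lt_trans _ nYa)// divr_gt0.
have a0r : 0 <= a < r by rewrite ltW.
have [psi [g [tpsi psi0 psic dpsi gpsi]]] := step_test_function a0r cO.
have E1 : penergy 1 psi < Y * pmass 1 psi.
  have := step_energy a0 tpsi psi0 dpsi gpsi.
  rewrite mulrC -ler_pdivlMr// => /le_lt_trans; apply.
  rewrite mulrAC ltr_pM2r; last first.
    by apply: (pmass_gt0 ltr01 tpsi (c := c)); rewrite gt_eqF.
  by rewrite ltr_pdivrMr// mulrC -ltr_pdivrMr.
have [e /= e00 He] : \forall q \near (1 : R), penergy q psi < Y * pmass q psi.
  exact: (energy_lt_near tpsi ltr01 E1).
have small p : 1 < p -> p < 1 + e -> lambda1 p Omega < Y.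
  move=> p1 pe; apply: (lambda1_lt openO _ tpsi); first by rewrite (lt_trans _ p1).
  by apply: He; rewrite /= ltr_norml; lra.
pose al := Num.min (1 + e / 2) p0.
have al1 : 1 < al by rewrite lt_min p01 andbT; lra.
have alp : al <= p0 by rewrite ge_min lexx orbT.
have ale : al < 1 + e by rewrite gt_min; apply/orP; left; lra.
pose be := Num.max P p0.
have bep : p0 <= be by rewrite le_max lexx orbT.
have beP : P <= be by rewrite le_max lexx.
split.
  have [|p y /andP[alp' _]|m /andP[alm _] hm] :=
      @usc_attains_max R (fun p => lambda1 p Omega) al be.
  - by rewrite (le_trans alp).
  - have p1 : 1 < p by rewrite (lt_le_trans al1).
    by apply: (lambda1_lt_near openO p1 tphi); apply: E0; rewrite (lt_trans _ p1).
  exists m; split; first by rewrite (lt_le_trans al1).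
  have Ym : Y <= lambda1 m Omega by apply: (le_trans YL); rewrite hm// alp.
  move=> p p1; have [pal|alp'] := ltP p al.
    by rewrite (le_trans _ Ym)// ltW// small// (lt_trans pal).
  have [bp|pbe] := ltP be p.
    by rewrite (le_trans _ Ym)// ltW// large// (le_trans beP)// ltW.
  by rewrite hm// alp'.
split => H.
  have be1 : 1 < be by rewrite (lt_le_trans p01).
  have := H p0 be; rewrite /= !in_itv/= !andbT => /(_ p01 be1 bep).
  by rewrite leNgt (lt_le_trans (large _ be1 beP)).
have := H al p0; rewrite /= !in_itv/= !andbT => /(_ al1 p01 alp).
by rewrite leNgt (lt_le_trans (small _ al1 ale)).
Qed.
End main.

Unset Implicit Arguments.

Theorem propositionB1 (R : realType) (N : nat) (hN : (2 <= N)%N) :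
  (forall (r Rad : R) (Omega : set 'rV[R]_N),
     1 < r < expR 1 -> 1 < Rad < expR 1 ->
     bounded_domain Omega -> C2_boundary Omega ->
     Num.max 1 (expR 1 * ln Rad) < r -> r <= Rad -> Rad < expR 1 ->
     (exists c, eball c r `<=` Omega) ->
     (exists c, Omega `<=` eball c Rad) ->
     (exists pstar : R, 1 < pstar /\
        forall p, 1 < p -> lambda1 p Omega <= lambda1 pstar Omega) /\
     non_monotone `]1, +oo[ (fun p => lambda1 p Omega)) /\
  (forall (Rad : R) (c : 'rV[R]_N), 1 < Rad < expR 1 ->
     non_monotone `]1, +oo[ (fun p => lambda1 p (eball c Rad))).
Proof.
have N0 : (0 < N)%N by rewrite (leq_trans _ hN).
split.
  move=> r Rad Omega _ Rad1 [oO _ _ _] _ + _ _ [c cO] [c' Oc'].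
  rewrite gt_max => /andP[r1 er].
  exact: (lambda1_max_nonmonotone oO N0 r1 Rad1 er cO Oc').
move=> Rad c Rad1; have /andP[R1 Re] := Rad1.
have R0 : 0 < Rad by rewrite (lt_trans _ R1).
have er : expR 1 * ln Rad < Rad.
  have l1 : ln Rad - 1 != 0.
    by rewrite subr_eq0 lt_eqF// -[ltRHS]expRK ltr_ln ?posrE// expR_gt0.
  have := expR_gt1Dx l1; rewrite addrC subrK expRB lnK ?posrE//.
  by rewrite ltr_pdivlMr ?expR_gt0// mulrC.
have sub : eball c Rad `<=` eball c Rad by [].
by have [] := lambda1_max_nonmonotone (@open_eball R N c Rad) N0 R1 Rad1 er sub sub.
Qed.
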